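(* Let $g:\mathbb R^d\to[0,\infty)$ be continuously differentiable with $L$-Lipschitz gradient, let $q>1/2$, and let $$S_n=S_{n-1}+\|G_n\|^2,\qquad \theta_{n+1}=\theta_n-\alpha_0S_n^{-q}G_n,\qquad n\ge1,$$ with deterministic $\theta_1\in\mathbb R^d$, $S_0>0$ and $\alpha_0>0$. Assume that, almost surely for every $n\ge1$, $$\mathbb E[G_n\mid\mathscr F_{n-1}]=\nabla g(\theta_n),\qquad \mathbb E[\|G_n\|^2\mid\mathscr F_{n-1}]\le\beta\|\nabla g(\theta_n)\|^2+\sigma^2$$ for finite constants $\beta,\sigma\ge0$, and suppose further that for some deterministic $K<\infty$, $$\mathbb E[\|G_n\|^2\mid\mathscr F_{n-1}]\le K\quad\text{almost surely for every }n.$$ Then $$\mathbb E\Big[\sup_{n\ge1}g(\theta_n)\Big]<\infty .$$ If moreover $q\le1$, then also $\mathbb E\|\nabla g(\theta_n)\|^2\to0$.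
   Context: $(\Omega,\mathscr F,\mathbb P)$ is a probability space with a filtration $\{\mathscr F_n\}_{n\ge0}$. For each $n\ge1$, $\theta_n$ and $S_{n-1}$ are $\mathscr F_{n-1}$-measurable, and the stochastic gradient $G_n$ (an $\mathbb R^d$-valued random vector) is $\mathscr F_n$-measurable. $\|\cdot\|$ is the Euclidean norm. *)

(* Defs.v *)
From HB Require Import structures.
From mathcomp Require Import all_boot all_order all_algebra.
From mathcomp Require Import all_classical all_reals all_analysis.
From mathcomp Require Import measurable_realfun.
Import Order.TTheory GRing.Theory Num.Theory.
Import numFieldNormedType.Exports.

Set Implicit Arguments.
Unset Strict Implicit.
Unset Printing Implicit Defensive.

Local Open Scope classical_set_scope.
Local Open Scope ring_scope.

(* R^d is ['rV[R]_d]. The library norm [`|v|] on it is the sup norm. The two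
   norms are equivalent, so differentiability, continuity and open sets are unaffected. *)
Definition enorm (R : realType) (d : nat) (v : 'rV[R]_d) : R :=
  Num.sqrt (\sum_(i < d) v 0 i ^+ 2).

Definition grad (R : realType) (d : nat) (g : 'rV[R]_d -> R) (x : 'rV[R]_d) :
  'rV[R]_d := \row_(i < d) 'D_(delta_mx 0 i) g x.

Definition continuously_differentiable (R : realType) (d : nat)
    (g : 'rV[R]_d -> R) : Prop :=
  (forall x, differentiable g x) /\ continuous (grad g).

Definition borel_rV (R : realType) (d : nat) :=
  g_sigma_algebraType (@open 'rV[R]_d).

Definition filtration (disp : measure_display) (T : measurableType disp)
    (F : nat -> set (set T)) : Prop :=
  [/\ forall n, sigma_algebra [set: T] (F n),
      forall n, F n `<=` @measurable disp T
    & forall m n, (m <= n)%N -> F m `<=` F n].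

(* [H]-measurability of [X]: for a sigma-algebra [H], the measurable
   sets of [g_sigma_algebraType H] are exactly the members of [H]. *)
Definition measurable_wrt (disp' : measure_display) (T : pointedType)
    (U : measurableType disp') (H : set (set T)) (X : T -> U) : Prop :=
  measurable_fun [set: g_sigma_algebraType H]
    (X : g_sigma_algebraType H -> U).

(* [Y] is a version of E[X | H]. [X] is integrable or nonnegative; in the latter
   case both sides of the averaging identity may be [+oo]. *)
Definition cond_exp (disp : measure_display) (T : measurableType disp)
    (R : realType) (P : probability T R) (H : set (set T))
    (X Y : T -> \bar R) : Prop :=
  [/\ measurable_fun [set: T] X,
      P.-integrable [set: T] X \/ (forall w, (0 <= X w)%E),
      measurable_wrt H Y
    & forall A, H A -> (\int[P]_(w in A) Y w = \int[P]_(w in A) X w)%E].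

Definition cond_exp_rV (disp : measure_display) (T : measurableType disp)
    (R : realType) (P : probability T R) (H : set (set T)) (d : nat)
    (X Y : T -> 'rV[R]_d) : Prop :=
  forall i : 'I_d,
    P.-integrable [set: T] (fun w => (X w 0 i)%:E) /\
    cond_exp P H (fun w => (X w 0 i)%:E) (fun w => (Y w 0 i)%:E).

(* Main.v *)
Require Import Defs.
From HB Require Import structures.
From mathcomp Require Import all_boot all_order all_algebra.
From mathcomp Require Import all_classical all_reals all_analysis.
From mathcomp Require Import measurable_realfun ring lra.
Import Order.TTheory GRing.Theory Num.Theory.
Import numFieldNormedType.Exports.

Set Implicit Arguments.
Unset Strict Implicit.
Unset Printing Implicit Defensive.

Local Open Scope classical_set_scope.
Local Open Scope ring_scope.

(** Let a_n = alpha0 S_n^(-q), so that the step from theta_n to theta_(n+1) has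
    size a_n, while a_(n-1) is the size that is known before the gradient G_n is
    drawn.

    The objective. The descent inequality bounds g(theta_(n+1)) - g(theta_n) by
    - a_n <grad g, G_n> plus a multiple of a_n^2 |G_n|^2. The second-order terms
    have a deterministic finite sum, because S_n - S_(n-1) = |G_n|^2 and 2 q > 1
    make the sum of S^(-2q) dS telescope ([powR_increment]). In the first-order
    term, a_n is replaced by a_(n-1). The error is (a_(n-1) - a_n) <grad g, G_n>,
    and since 0 <= a_(n-1) - a_n <= a_(n-1), the arithmetic-geometric inequality
    bounds it by a term of mean at most half of E [a_(n-1) |grad g|^2], the
    expected decrease, and a multiple of a_(n-1) - a_n, which telescopes
    ([potential_step]). Taking means, the sum of
    E [a_(n-1) |grad g(theta_n)|^2] is finite ([energy_sum_le]). Along a path,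
    g(theta_n) is then at most a constant, plus a martingale, plus a nondecreasing
    process of bounded mean. The increments of the martingale have variance at
    most a constant times E [a_(n-1) |grad g|^2], so its running maximum has
    bounded mean ([mean_runmax_le]), which gives the first conclusion
    ([mean_runmax_g_le], [integral_sup_g_le]).

    The gradient, when q <= 1. It is enough that P(|grad g(theta_n)|^2 >= 4 e)
    tends to 0 for each e > 0, since E [|G_n|^2 | F_(n-1)] <= K bounds the
    contribution of that event to the mean by K times its probability
    ([mean_gsq_le]). Suppose that |grad g|^2 >= 4 e at time n. Either it falls
    below e later, or it never does.
    In the first case theta travels a fixed distance while |grad g|^2 >= e. The
    displacement is a martingale plus terms bounded, thanks to this lower bound on
    the gradient, by 1 / e times summable quantities, and the variance of the
    martingale is bounded in the same way; so the mean of the largest displacement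
    over all horizons is small for large n ([mean_excursion_le]).
    The second case has probability zero: the mean of S_n grows at most linearly,
    so E [a_(n-1) |grad g|^2] would be bounded below by a multiple of 1 / n, and
    the harmonic series diverges ([mean_stay_small]). All of this is carried out
    on finite horizons, so no almost sure limit is taken. *)

(** * Means of integrable functions *)

Section RealExpectation.
Context (R : realType) (disp : measure_display) (T : measurableType disp)
  (P : probability T R).
Implicit Types (f h Z : T -> R).

Definition L1 f := P.-integrable [set: T] (EFin \o f).
(** A real number instead of an extended one, so that linear arithmetic
    applies to inequalities between means; the rules of calculation below ask
    for integrability. *)
Definition mean f : R := \int[P]_w f w.

Lemma L1_measurable f : L1 f -> measurable_fun [set: T] f.
Proof. by move=> /measurable_int /measurable_EFinP. Qed.

Lemma L1_dominated f h : measurable_fun [set: T] f -> L1 h ->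
  (forall w, `|f w| <= h w) -> L1 f.
Proof.
move=> mf ih fh; apply: (le_integrable measurableT _ _ ih).
  exact/measurable_EFinP.
by move=> w _ /=; rewrite lee_fin (le_trans (fh w))// ler_norm.
Qed.

Lemma L1_cst c : L1 (fun=> c).
Proof. exact: finite_measure_integrable_cst. Qed.

Lemma L1_bounded f c : measurable_fun [set: T] f ->
  (forall w, `|f w| <= c) -> L1 f.
Proof. by move=> mf; apply: L1_dominated => //; exact: L1_cst. Qed.

Lemma L1D f h : L1 f -> L1 h -> L1 (fun w => f w + h w).
Proof. exact: integrableD. Qed.

Lemma L1Z c f : L1 f -> L1 (fun w => c * f w).
Proof. exact: integrableZl. Qed.

Lemma L1N f : L1 f -> L1 (fun w => - f w).
Proof. exact: integrableN. Qed.

Lemma L1B f h : L1 f -> L1 h -> L1 (fun w => f w - h w).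
Proof. by move=> *; apply: L1D => //; apply: L1N. Qed.

Lemma L1_sum I (s : seq I) (f : I -> T -> R) :
  (forall i, L1 (f i)) -> L1 (fun w => \sum_(i <- s) f i w).
Proof.
move=> fi; have := @integrable_sum _ _ _ P _ measurableT _ s xpredT
  (fun i w => (f i w)%:E) (fun i _ => fi i).
by apply: eq_integrable => // w _; rewrite /= sumEFin.
Qed.

Lemma L1_norm f : L1 f -> L1 (fun w => `|f w|).
Proof. exact: integrable_norm. Qed.

Lemma L1_mul_bounded Z f c : measurable_fun [set: T] Z ->
  (forall w, `|Z w| <= c) -> L1 f -> L1 (fun w => Z w * f w).
Proof.
move=> mZ Zc fi; apply: (L1_dominated _ (L1Z c (L1_norm fi))).
  by apply: measurable_funM => //; exact: L1_measurable.
by move=> w; rewrite normrM ler_wpM2r.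
Qed.

Lemma eq_mean f h : f =1 h -> mean f = mean h.
Proof. by move=> fh; apply: eq_Rintegral => w _; rewrite fh. Qed.

Lemma meanD f h : L1 f -> L1 h -> mean (fun w => f w + h w) = mean f + mean h.
Proof. exact: RintegralD. Qed.

Lemma meanB f h : L1 f -> L1 h -> mean (fun w => f w - h w) = mean f - mean h.
Proof. exact: RintegralB. Qed.

Lemma meanZ c f : L1 f -> mean (fun w => c * f w) = c * mean f.
Proof. exact: RintegralZl. Qed.

Lemma mean_cst c : mean (fun=> c) = c.
Proof.
rewrite /mean Rintegral_cst//.
by rewrite (_ : fine _ = 1) ?mulr1//; have /= -> := probability_setT P.
Qed.

Lemma le_mean f h : L1 f -> L1 h -> (forall w, f w <= h w) -> mean f <= mean h.
Proof. by move=> fi hi fh; apply: le_Rintegral. Qed.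

Lemma mean_ge0 f : (forall w, 0 <= f w) -> 0 <= mean f.
Proof. by move=> f0; apply: Rintegral_ge0. Qed.

Lemma mean_sum I (s : seq I) (f : I -> T -> R) : (forall i, L1 (f i)) ->
  mean (fun w => \sum_(i <- s) f i w) = \sum_(i <- s) mean (f i).
Proof.
move=> fi; elim: s => [|i s IH].
  by rewrite big_nil -[RHS](mean_cst 0); apply: eq_mean => w; rewrite big_nil.
rewrite big_cons -IH -meanD//; last exact: L1_sum.
by apply: eq_mean => w; rewrite big_cons.
Qed.

Lemma mean_EFin f : L1 f -> (\int[P]_w (f w)%:E)%E = (mean f)%:E.
Proof. by move=> fi; rewrite /mean /Rintegral fineK//; exact: integrable_fin_num. Qed.

Definition L2 f := measurable_fun [set: T] f /\ L1 (fun w => f w ^+ 2).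

(** |f h| <= f^2 + h^2. *)
Lemma L2_mul f h : L2 f -> L2 h -> L1 (fun w => f w * h w).
Proof.
move=> [mf f2] [mh h2]; apply: (L1_dominated _ (L1D f2 h2)).
  exact: measurable_funM.
move=> w; rewrite normrM -[f w ^+ 2]real_normK ?num_real//.
rewrite -[h w ^+ 2]real_normK ?num_real//.
by have := sqr_ge0 (`|f w| - `|h w|); nra.
Qed.

Lemma L2_bounded f c : measurable_fun [set: T] f ->
  (forall w, `|f w| <= c) -> L2 f.
Proof.
move=> mf fc; split=> //.
apply: (@L1_bounded _ (c ^+ 2)); first exact: measurable_funX.
by move=> w; rewrite normrX; apply: lerXn2r => //; rewrite nnegrE ?(le_trans _ (fc w)).
Qed.

Lemma L2_L1 f : L2 f -> L1 f.
Proof.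
move=> sf; have : L1 (fun w => f w * 1).
  by apply: L2_mul => //; apply: (@L2_bounded _ 1) => // w; rewrite normr1.
by apply: eq_integrable => // w _ /=; rewrite mulr1.
Qed.

Lemma L2D f h : L2 f -> L2 h -> L2 (fun w => f w + h w).
Proof.
move=> [mf f2] [mh h2]; split; first exact: measurable_funD.
apply: (L1_dominated _ (L1D (L1Z 2 f2) (L1Z 2 h2))).
  by apply: measurable_funX; exact: measurable_funD.
move=> w; rewrite ger0_norm ?sqr_ge0//.
by have := sqr_ge0 (f w - h w); nra.
Qed.

Lemma L2_mul_bounded Z f c : measurable_fun [set: T] Z ->
  (forall w, `|Z w| <= c) -> L2 f -> L2 (fun w => Z w * f w).
Proof.
move=> mZ Zc [mf f2]; split; first exact: measurable_funM.
have -> : (fun w => (Z w * f w) ^+ 2) = (fun w => Z w ^+ 2 * f w ^+ 2).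
  by apply/funext => w; rewrite exprMn.
apply: (@L1_mul_bounded _ _ (c ^+ 2)) => //; first exact: measurable_funX.
by move=> w; rewrite normrX; apply: lerXn2r => //; rewrite nnegrE ?(le_trans _ (Zc w)).
Qed.

Lemma L2N f : L2 f -> L2 (fun w => - f w).
Proof.
move=> [mf f2]; split; first exact: measurableT_comp.
by apply: eq_integrable f2 => // w _ /=; rewrite sqrrN.
Qed.

Lemma L2B f h : L2 f -> L2 h -> L2 (fun w => f w - h w).
Proof. by move=> *; apply: L2D => //; apply: L2N. Qed.

Lemma L2_sum I (s : seq I) (f : I -> T -> R) :
  (forall i, L2 (f i)) -> L2 (fun w => \sum_(i <- s) f i w).
Proof.
move=> sf; elim: s => [|i s IH].
  have -> : (fun w => \sum_(i <- [::]) f i w) = (fun=> 0).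
    by apply/funext => w; rewrite big_nil.
  by apply: (@L2_bounded _ 0) => // w; rewrite normr0.
have -> : (fun w => \sum_(j <- i :: s) f j w) =
          (fun w => f i w + \sum_(j <- s) f j w).
  by apply/funext => w; rewrite big_cons.
exact: L2D.
Qed.

Lemma L2_max f h : L2 f -> L2 h -> L2 (fun w => Num.max (f w) (h w)).
Proof.
move=> [mf f2] [mh h2]; split; first exact: measurable_maxr.
apply: (L1_dominated _ (L1D f2 h2)).
  by apply: measurable_funX; exact: measurable_maxr.
move=> w; rewrite ger0_norm ?sqr_ge0//.
by have := sqr_ge0 (f w); have := sqr_ge0 (h w); rewrite /Num.max; case: ifP => _; lra.
Qed.

End RealExpectation.
(** * Weights measurable for a sub-sigma-algebra *)

Section SubSigmaAlgebra.
Context (R : realType) (disp : measure_display) (T : measurableType disp)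
  (P : probability T R).
Implicit Types (H : set (set T)) (Z W Y : T -> R).
Import HBNNSimple.

Lemma measurable_wrt_preimage disp' (U : measurableType disp') H (X : T -> U) B :
  sigma_algebra [set: T] H -> measurable_wrt H X -> measurable B ->
  H (X @^-1` B).
Proof.
move=> sH mX mB; have := mX measurableT _ mB; rewrite setTI.
by rewrite measurable_g_measurableTypeE.
Qed.

Lemma measurable_wrt_sub disp' (U : measurableType disp') H H' (X : T -> U) :
  sigma_algebra [set: T] H -> H `<=` H' ->
  measurable_wrt H X -> measurable_wrt H' X.
Proof.
move=> sH HH' mX _ B mB; rewrite setTI; apply: sub_sigma_algebra.
by apply: HH'; exact: measurable_wrt_preimage mX mB.
Qed.

Lemma measurable_wrt_fun disp' (U : measurableType disp') H (X : T -> U) :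
  sigma_algebra [set: T] H -> H `<=` @measurable disp T ->
  measurable_wrt H X -> measurable_fun [set: T] X.
Proof.
move=> sH HT mX _ B mB; rewrite setTI; apply: HT.
exact: measurable_wrt_preimage mX mB.
Qed.

(** Nonnegativity against the indicators of [H] passes to nonnegative simple
    functions by linearity, and from them to [Z] by dominated convergence,
    since the approximations of [Z] lie below [Z]. This is how averaging
    identities over events become identities with weights. *)
Lemma mean_mul_ge0 H W Z :
  sigma_algebra [set: T] H -> H `<=` @measurable disp T ->
  L1 P W -> (forall A, H A -> 0 <= mean P (fun w => \1_A w * W w)) ->
  measurable_wrt H Z -> (forall w, 0 <= Z w) ->
  L1 P (fun w => Z w * W w) -> 0 <= mean P (fun w => Z w * W w).
Proof.
move=> sH HT iW posW mZ Z0 iZW.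
have mZe : measurable_fun [set: g_sigma_algebraType H]
    (EFin \o Z : g_sigma_algebraType H -> \bar R) by exact/measurable_EFinP.
pose f n : {nnsfun g_sigma_algebraType H >-> R} := nnsfun_approx measurableT mZe n.
have fZ w : f^~ w @ \oo --> Z w.
  have Z0e x : [set: g_sigma_algebraType H] x -> (0 <= (EFin \o Z) x)%E.
    by move=> _; rewrite lee_fin.
  by have /fine_cvgP[_] := cvg_nnsfun_approx measurableT mZe Z0e (I : setT w).
have f_le n w : f n w <= Z w.
  rewrite -(cvg_lim (@Rhausdorff R) (fZ w)).
  apply: (nondecreasing_cvgn_le _ (cvgP _ (fZ w))).
  by move=> k m km; have /lefP := nd_nnsfun_approx measurableT mZe km; exact.
have f_meas n : measurable_wrt H (f n) by exact: measurable_funP.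
have f_pos n : 0 <= mean P (fun w => f n w * W w).
  pose s : seq R := finmap.enum_fset (fset_set (f n @` [set: T])).
  have fE w : f n w = \sum_(i < size s) s`_i * \1_(f n @^-1` [set s`_i]) w.
    exact: fimfunEord.
  have A_H i : H (f n @^-1` [set s`_i]).
    by apply: measurable_wrt_preimage (f_meas n) _.
  have iA i : L1 P (fun w => \1_(f n @^-1` [set s`_i]) w * W w).
    apply: (@L1_mul_bounded _ _ _ _ _ _ 1) => //.
      by apply: measurable_indic; exact: HT.
    by move=> w; rewrite indicE; case: (_ \in _); rewrite ?normr1 ?normr0.
  have -> : mean P (fun w => f n w * W w) = mean P (fun w : T => \sum_(i < size s)
      s`_i * (\1_(f n @^-1` [set s`_i] : set T) w * W w)).
    apply: eq_mean => w; rewrite fE mulr_suml; apply: eq_bigr => i _.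
    by rewrite mulrA.
  rewrite mean_sum; last by move=> i; exact: L1Z.
  apply: sumr_ge0 => i _; rewrite meanZ//; apply: mulr_ge0; last exact: posW.
  suff /set_mem[w _ <-] : s`_i \in f n @` [set: T] by [].
  by rewrite -in_fset_set; [exact: (@mem_nth _ 0 s)|exact: (fimfunP (f n))].
have mW := L1_measurable iW.
have [] := @dominated_convergence _ _ _ P _ measurableT
  (fun n w => (f n w * W w)%:E) (fun w => (Z w * W w)%:E)
  (fun w => `|Z w * W w|%:E).
- move=> k; apply/measurable_EFinP; apply: measurable_funM => //.
  exact: measurable_wrt_fun (f_meas _).
- by apply/measurable_EFinP; exact: L1_measurable iZW.
- apply: aeW => w _; apply/fine_cvgP; split; first exact: nearW.
  by apply: cvgMl; exact: fZ.
- exact: L1_norm.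
- apply: aeW => w k _; rewrite /= lee_fin !normrM ler_wpM2r//.
  by rewrite !ger0_norm.
move=> _ _ cvgI.
rewrite -lee_fin -mean_EFin//; apply: (cvge_to_ge cvgI) => //.
apply: nearW => k /=.
have iFW : L1 P (fun w : T => f k w * W w).
  apply: (L1_dominated _ (L1_norm iZW)).
    by apply: measurable_funM => //; exact: measurable_wrt_fun (f_meas _).
  by move=> w; rewrite !normrM ler_wpM2r// !ger0_norm.
by rewrite [leRHS](mean_EFin iFW) lee_fin; exact: f_pos.
Qed.

(** The hypothesis gives both inequalities of the previous lemma, for [W] and
    [- W]; a signed weight is the difference of its positive and negative
    parts. *)
Lemma mean_mul_eq0 H W Z :
  sigma_algebra [set: T] H -> H `<=` @measurable disp T ->
  (forall A, H A -> mean P (fun w => \1_A w * W w) = 0) ->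
  measurable_wrt H Z -> L2 P Z -> L2 P W ->
  mean P (fun w => Z w * W w) = 0.
Proof.
move=> sH HT W0 mZ sZ sW.
have mZ' := measurable_wrt_fun sH HT mZ.
have iYW Y : measurable_wrt H Y -> (forall w, 0 <= Y w <= `|Z w|) ->
    L1 P (fun w => Y w * W w).
  move=> mY YZ; apply: (L1_dominated _ (L1_norm (L2_mul sZ sW))).
    by apply: measurable_funM; [exact: measurable_wrt_fun mY|case: sW].
  move=> w; rewrite !normrM ler_wpM2r//.
  by case/andP: (YZ w) => Y0 YZw; rewrite ger0_norm.
have iA A : H A -> L1 P (fun w => \1_A w * W w).
  move=> HA; apply: (@L1_mul_bounded _ _ _ _ _ _ 1); last exact: L2_L1.
    by apply: measurable_indic; exact: HT.
  by move=> w; rewrite indicE; case: (_ \in _); rewrite ?normr1 ?normr0.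
have part Y : measurable_wrt H Y -> (forall w, 0 <= Y w <= `|Z w|) ->
    mean P (fun w => Y w * W w) = 0.
  move=> mY YZ; have Y0 w : 0 <= Y w by case/andP: (YZ w).
  apply/eqP; rewrite eq_le; apply/andP; split; last first.
    apply: (mean_mul_ge0 sH HT _ _ mY) => //; [exact: L2_L1| |exact: iYW].
    by move=> A HA; rewrite W0.
  rewrite -oppr_ge0 -mulN1r -meanZ; last exact: iYW.
  have -> : (fun w => -1 * (Y w * W w)) = (fun w => Y w * (-1 * W w)).
    by apply/funext => w; rewrite mulrCA.
  apply: (mean_mul_ge0 sH HT _ _ mY) => //.
  - by apply: L1Z; exact: L2_L1.
  - move=> A HA; have -> : (fun w => \1_A w * (-1 * W w)) =
                           (fun w => -1 * (\1_A w * W w)).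
      by apply/funext => w; rewrite mulrCA.
    by rewrite meanZ ?W0 ?mulr0//; exact: iA.
  - have -> : (fun w => Y w * (-1 * W w)) = (fun w => -1 * (Y w * W w)).
      by apply/funext => w; rewrite mulrCA.
    by apply: L1Z; exact: iYW.
pose Zp w := Num.max (Z w) 0; pose Zm w := Num.max (- Z w) 0.
have mZp : measurable_wrt H Zp by exact: measurable_maxr.
have mZm : measurable_wrt H Zm.
  by apply: measurable_maxr => //; exact: measurableT_comp.
have Zp_le w : 0 <= Zp w <= `|Z w|.
  by rewrite /Zp le_max lexx orbT ge_max ler_norm normr_ge0.
have Zm_le w : 0 <= Zm w <= `|Z w|.
  by rewrite /Zm le_max lexx orbT ge_max -normrN ler_norm normr_ge0.
have -> : (fun w => Z w * W w) = (fun w => Zp w * W w - Zm w * W w).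
  apply/funext => w; rewrite -mulrBl; congr (_ * _).
  by rewrite /Zp /Zm /Num.max; case: ifP; case: ifP; lra.
by rewrite meanB ?part ?subrr//; exact: iYW.
Qed.
End SubSigmaAlgebra.
(** * Conditional expectation as averaging over events *)

Section ConditionalExpectation.
Context (R : realType) (disp : measure_display) (T : measurableType disp)
  (P : probability T R).
Implicit Types (H : set (set T)).

Lemma mean_indic A (f : T -> R) :
  mean P (fun w => \1_A w * f w) = \int[P]_(w in A) f w.
Proof.
rewrite Rintegral_mkcond; apply: eq_mean => w; rewrite patchE indicE.
by case: ifP; rewrite ?mul1r ?mul0r.
Qed.

Lemma cond_exp_mean_indic H (X u : T -> R) (Y : T -> \bar R) A :
  sigma_algebra [set: T] H -> H `<=` @measurable disp T ->
  L1 P X -> L1 P u -> cond_exp P H (EFin \o X) Y ->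
  {ae P, forall w, Y w = (u w)%:E} -> H A ->
  mean P (fun w => \1_A w * (X w - u w)) = 0.
Proof.
move=> sH HT iX iu [_ _ mY intY] Yu HA; have mA := HT _ HA.
rewrite mean_indic RintegralB//; try exact: integrableS measurableT mA _ _.
apply/eqP; rewrite subr_eq0; apply/eqP; congr fine.
rewrite -(intY _ HA); apply: ae_eq_integral => //.
- by apply: measurable_funTS; exact: measurable_wrt_fun mY.
- by apply/measurable_EFinP/measurable_funTS; exact: L1_measurable iu.
- by apply: filterS Yu => w Yw _.
Qed.

Lemma cond_exp_le_integral H (X Y : T -> \bar R) (K : R) A :
  sigma_algebra [set: T] H -> H `<=` @measurable disp T ->
  0 <= K -> cond_exp P H X Y ->
  {ae P, forall w, (Y w <= K%:E)%E} -> H A ->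
  (\int[P]_(w in A) X w <= K%:E * P A)%E.
Proof.
move=> sH HT K0 [_ _ mY intY] YK HA; have mA := HT _ HA.
rewrite -(intY _ HA) integralE -integral_cst//.
(* [Y] is nonnegative only almost surely, hence the detour through its
   positive part. *)
apply: (@le_trans _ _ (\int[P]_(x in A) Y^\+ x)%E).
  by apply: geeDl; rewrite oppe_le0; exact: integral_ge0.
have mYp : measurable_fun A (Y^\+)%E.
  by apply/measurable_funepos/measurable_funTS; exact: measurable_wrt_fun mY.
apply: ae_ge0_le_integral => //.
by apply: filterS YK => w Yw _; rewrite funeposE ge_max Yw lee_fin.
Qed.

Lemma cond_exp_le_L1 H (X : T -> R) (Y : T -> \bar R) (K : R) :
  sigma_algebra [set: T] H -> H `<=` @measurable disp T ->
  0 <= K -> (forall w, 0 <= X w) -> cond_exp P H (EFin \o X) Y ->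
  {ae P, forall w, (Y w <= K%:E)%E} -> L1 P X.
Proof.
move=> sH HT K0 X0 cXY YK; apply/integrableP; split; first by case: cXY.
have -> : (\int[P]_w `|(EFin \o X) w|)%E = (\int[P]_w (X w)%:E)%E.
  by apply: eq_integral => w _ /=; rewrite ger0_norm.
have HTT : H [set: T].
  by have [H0 HC _] := sH; rewrite -[X in H X]setD0; exact: HC.
apply: le_lt_trans (cond_exp_le_integral sH HT K0 cXY YK HTT) _.
by have /= -> := probability_setT P; rewrite mule1 ltry.
Qed.

Lemma cond_exp_le_mean_mul H (X Z : T -> R) (Y : T -> \bar R) (K c : R) :
  sigma_algebra [set: T] H -> H `<=` @measurable disp T ->
  0 <= K -> (forall w, 0 <= X w) -> cond_exp P H (EFin \o X) Y ->
  {ae P, forall w, (Y w <= K%:E)%E} ->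
  measurable_wrt H Z -> (forall w, 0 <= Z w <= c) ->
  mean P (fun w => Z w * X w) <= K * mean P Z.
Proof.
move=> sH HT K0 X0 cXY YK mZ Zc.
have iX := cond_exp_le_L1 sH HT K0 X0 cXY YK.
have mZ' := measurable_wrt_fun sH HT mZ.
have Zc' w : `|Z w| <= c by case/andP: (Zc w) => Z0 ?; rewrite ger0_norm.
have iZX : L1 P (fun w => Z w * X w) by exact: L1_mul_bounded Zc' iX.
have iZ : L1 P Z by exact: L1_bounded Zc'.
have iKX : L1 P (fun w => K - X w) by apply: L1B => //; exact: L1_cst.
have E1 : (fun w => Z w * (K - X w)) = (fun w => K * Z w - Z w * X w).
  by apply/funext => w; rewrite mulrBr mulrC.
rewrite -subr_ge0 -meanZ// -meanB//; last exact: L1Z.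
rewrite -E1; apply: (mean_mul_ge0 sH HT iKX _ mZ); first last.
- by rewrite E1; apply: L1B => //; exact: L1Z.
- by move=> w; case/andP: (Zc w).
move=> A HA; have mA := HT _ HA.
rewrite mean_indic RintegralB//; last 2 first.
- exact: finite_measure_integrable_cst.
- exact: integrableS measurableT mA _ iX.
rewrite subr_ge0 Rintegral_cst// -lee_fin EFinM.
have iXA : P.-integrable A (EFin \o X) by exact: integrableS measurableT mA _ iX.
rewrite !fineK ?fin_num_measure//; last exact: integrable_fin_num.
exact: cond_exp_le_integral cXY YK HA.
Qed.

End ConditionalExpectation.
(** * The maximal inequality for square-integrable martingales *)

Section RunningMaximum.
Context (R : realType).
Implicit Types (X D : nat -> R).

Fixpoint runmax X n : R :=
  if n is m.+1 then Num.max (runmax X m) (X n) else X 0%N.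

Lemma runmax_ge X k n : (k <= n)%N -> X k <= runmax X n.
Proof.
elim: n => [|n IH]; first by rewrite leqn0 => /eqP ->.
rewrite leq_eqVlt => /predU1P[->|/IH kn] /=; first by rewrite le_max lexx orbT.
by rewrite le_max kn.
Qed.

Lemma runmax_le X n c : (forall k, (k <= n)%N -> X k <= c) -> runmax X n <= c.
Proof.
elim: n => [|n IH] Xc /=; first exact: Xc.
by rewrite ge_max Xc// IH// => k kn; apply: Xc; exact: leqW.
Qed.

Definition psum D n : R := \sum_(k < n) D k.

Lemma psumS D n : psum D n.+1 = psum D n + D n.
Proof. by rewrite /psum big_ord_recr. Qed.

(** A pathwise form of the maximal inequality of Doob. The terms of the last
    sum are increments [D k] with weights that depend on the earlier
    increments, so they average to zero for a martingale, and what remains is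
    linear in the squared increments. It follows from r^2 <= 4 X^2 - 4
    (weighted increments), where r is the running maximum of the partial sums
    X, and r <= eta + r^2 / (4 eta). *)
Lemma runmax_psum_le D (eta : R) n : 0 < eta ->
  runmax (psum D) n <= eta + eta^-1 * (\sum_(k < n) D k ^+ 2)
    + (4 * eta)^-1 * (\sum_(k < n) (8 * psum D k - 4 * runmax (psum D) k) * D k).
Proof.
move=> eta0; set r := runmax (psum D).
(* 2 r X - r^2 grows by at least 2 r D at each step, with r the maximum before
   the step: when the maximum is unchanged this is an equality, and otherwise
   the difference is a square. *)
have rX : r n ^+ 2 - 2 * r n * psum D n + \sum_(k < n) 2 * r k * D k <= 0.
  elim: n => [|n IH].
    by rewrite big_ord0 /r /= /psum big_ord0 expr0n /= !mulr0 subr0 addr0.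
  rewrite big_ord_recr /= psumS /r /= -/(r n) psumS.
  rewrite /Num.max; case: ltP => _; last by lra.
  have := sqr_ge0 (r n - (psum D n + D n)).
  by move: IH; set s := \sum_(k < n) _; nra.
have X2 : psum D n ^+ 2 = \sum_(k < n) (2 * psum D k * D k + D k ^+ 2).
  elim: n {rX} => [|n IH]; first by rewrite big_ord0 /psum big_ord0 expr0n.
  by rewrite big_ord_recr /= -IH psumS; ring.
have r2 : r n ^+ 2 <= 4 * (\sum_(k < n) D k ^+ 2)
    + \sum_(k < n) (8 * psum D k - 4 * r k) * D k.
  have -> : \sum_(k < n) (8 * psum D k - 4 * r k) * D k =
      4 * (\sum_(k < n) (2 * psum D k * D k + D k ^+ 2))
      - 4 * (\sum_(k < n) D k ^+ 2) - 2 * (\sum_(k < n) 2 * r k * D k).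
    rewrite !mulr_sumr -!sumrB; apply: eq_bigr => k _; ring.
  rewrite -X2; have := sqr_ge0 (r n - 2 * psum D n).
  by move: rX; set s := \sum_(k < n) 2 * r k * D k; nra.
set A := \sum_(k < n) D k ^+ 2 in r2 *.
set B := \sum_(k < n) _ in r2 *.
have e2 := sqr_ge0 (r n - 2 * eta).
have -> : eta + eta^-1 * A + (4 * eta)^-1 * B =
  (4 * eta)^-1 * (4 * eta ^+ 2 + (4 * A + B)) by field; lra.
rewrite mulrC ler_pdivlMr; last by lra.
by lra.
Qed.

End RunningMaximum.

Section MartingaleMaximum.
Context (R : realType) (disp : measure_display) (T : measurableType disp)
  (P : probability T R) (F : nat -> set (set T)) (D : nat -> T -> R).
Hypothesis F_filtration : filtration F.
Hypothesis D_adapted : forall k, measurable_wrt (F k.+1) (D k).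
Hypothesis D_L2 : forall k, L2 P (D k).
Hypothesis D_centred : forall k Z, measurable_wrt (F k) Z -> L2 P Z ->
  mean P (fun w => Z w * D k w) = 0.

Local Notation Mart w := (psum (D^~ w)).

Lemma measurable_wrt_later m n (Z : T -> R) : (m <= n)%N ->
  measurable_wrt (F m) Z -> measurable_wrt (F n) Z.
Proof.
have [sF _ Fmn] := F_filtration => mn; apply: measurable_wrt_sub => //.
exact: Fmn.
Qed.

Lemma psum_adapted n : measurable_wrt (F n) (fun w => Mart w n).
Proof.
elim: n => [|n IH].
  have -> : (fun w => Mart w 0) = (fun=> 0) by apply/funext => w; rewrite /psum big_ord0.
  exact: measurable_cst.
have -> : (fun w => Mart w n.+1) = (fun w => Mart w n + D n w).
  by apply/funext => w; rewrite psumS.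
by apply: measurable_funD; [exact: measurable_wrt_later IH|exact: D_adapted].
Qed.

Lemma psum_L2 n : L2 P (fun w => Mart w n).
Proof. exact: (L2_sum (index_enum 'I_n)). Qed.

Lemma runmax_adapted n : measurable_wrt (F n) (fun w => runmax (Mart w) n).
Proof.
elim: n => [|n IH] /=; first exact: psum_adapted.
by apply: measurable_maxr; [exact: measurable_wrt_later IH|exact: psum_adapted].
Qed.

Lemma runmax_L2 n : L2 P (fun w => runmax (Mart w) n).
Proof.
elim: n => [|n IH] /=; first exact: psum_L2.
exact: L2_max IH (psum_L2 _).
Qed.

(** Taking means in the pathwise inequality: the weights 8 X - 4 r are square
    integrable and known before the increment they multiply. *)
Lemma mean_runmax_le eta n : 0 < eta ->
  mean P (fun w => runmax (Mart w) n) <=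
  eta + eta^-1 * (\sum_(k < n) mean P (fun w => D k w ^+ 2)).
Proof.
move=> eta0.
pose Z k w := 8 * Mart w k - 4 * runmax (Mart w) k.
have mZ k : measurable_wrt (F k) (Z k).
  apply: measurable_funB; apply: measurable_funM => //.
    exact: psum_adapted.
  exact: runmax_adapted.
have sZ k : L2 P (Z k).
  apply: L2B; apply: (@L2_mul_bounded _ _ _ _ _ _ 8) => //.
  - by move=> _; rewrite ger0_norm.
  - exact: psum_L2.
  - by move=> _; rewrite ger0_norm// ler_nat.
  - exact: runmax_L2.
have iZ k : L1 P (fun w => Z k w * D k w) by exact: L2_mul.
have iD k : L1 P (fun w => D k w ^+ 2) by case: (D_L2 k).
have iZs : L1 P (fun w => \sum_(k < n) Z k w * D k w).
  exact: (L1_sum _ (fun k : 'I_n => iZ k)).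
have iDs : L1 P (fun w => \sum_(k < n) D k w ^+ 2).
  exact: (L1_sum _ (fun k : 'I_n => iD k)).
have iA : L1 P (fun w => eta + eta^-1 * (\sum_(k < n) D k w ^+ 2)).
  by apply: L1D; [exact: L1_cst|exact: L1Z].
apply: (le_trans (le_mean (L2_L1 (runmax_L2 n)) _
  (fun w => runmax_psum_le (D^~ w) n eta0))).
  by apply: L1D => //; exact: L1Z.
rewrite meanD//; last exact: L1Z.
rewrite meanD; [|exact: L1_cst|exact: L1Z].
rewrite mean_cst !meanZ// (mean_sum _ (fun k : 'I_n => iD k)).
rewrite (mean_sum _ (fun k : 'I_n => iZ k)) [X in _ + _ * X](_ : _ = 0).
  by rewrite mulr0 addr0.
by apply: big1 => k _; exact: D_centred.
Qed.

End MartingaleMaximum.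
(** * Euclidean norm and descent inequality *)

Section Descent.
Context (R : realType) (d : nat).
Implicit Types (u v x y : 'rV[R]_d) (g : 'rV[R]_d -> R).

Definition nsq v : R := \sum_(i < d) v 0 i ^+ 2.
Definition dot u v : R := \sum_(i < d) u 0 i * v 0 i.

Lemma nsq_ge0 v : 0 <= nsq v.
Proof. by apply: sumr_ge0 => i _; exact: sqr_ge0. Qed.

Lemma enorm_sqr v : enorm v ^+ 2 = nsq v.
Proof. by rewrite /enorm sqr_sqrtr// nsq_ge0. Qed.

Lemma dotE u v : 2 * dot u v = nsq u + nsq v - nsq (u - v).
Proof.
rewrite /nsq /dot mulr_sumr -big_split -sumrB /=; apply: eq_bigr => i _.
by rewrite !mxE; ring.
Qed.

Lemma dot_le u v : 2 * dot u v <= nsq u + nsq v.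
Proof. by rewrite dotE; have := nsq_ge0 (u - v); lra. Qed.

Lemma nsqD_le u v : nsq (u + v) <= 2 * nsq u + 2 * nsq v.
Proof.
rewrite /nsq !mulr_sumr -big_split /=; apply: ler_sum => i _.
by rewrite !mxE; have := sqr_ge0 (u 0 i - v 0 i); nra.
Qed.

Lemma nsqZ c v : nsq (c *: v) = c ^+ 2 * nsq v.
Proof. by rewrite /nsq mulr_sumr; apply: eq_bigr => i _; rewrite mxE exprMn. Qed.

Lemma nsqN v : nsq (- v) = nsq v.
Proof. by apply: eq_bigr => i _; rewrite mxE sqrrN. Qed.

Lemma nsq_le_norm1 v : nsq v <= (\sum_(i < d) `|v 0 i|) ^+ 2.
Proof.
rewrite expr2 mulr_suml; apply: ler_sum => i _.
rewrite -[_ ^+ 2]real_normK ?num_real// expr2 ler_wpM2l//.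
by rewrite (bigD1 i)//= lerDl sumr_ge0.
Qed.

Lemma nsq_comb a c u v :
  nsq (a *: v - c *: u) = a ^+ 2 * nsq v + c ^+ 2 * nsq u - 2 * a * c * dot u v.
Proof.
rewrite /nsq /dot !mulr_sumr -big_split -sumrB /=; apply: eq_bigr => i _.
by rewrite !mxE; ring.
Qed.

Lemma dot_sqr_le u v : dot u v ^+ 2 <= nsq u * nsq v.
Proof.
have [u0|u0] := eqVneq (nsq u) 0.
  have uE i : u 0 i = 0.
    apply/eqP; rewrite -sqrf_eq0; move/eqP: u0.
    rewrite /nsq psumr_eq0; last by move=> j _; exact: sqr_ge0.
    by move/allP => /(_ i); rewrite mem_index_enum => /(_ isT).
  by rewrite u0 mul0r /dot big1 ?expr0n// => i _; rewrite uE mul0r.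
have up : 0 < nsq u by rewrite lt_neqAle eq_sym u0 nsq_ge0.
have := nsq_ge0 (nsq u *: v - dot u v *: u).
have -> : nsq (nsq u *: v - dot u v *: u) =
    nsq u * (nsq u * nsq v - dot u v ^+ 2).
  by rewrite nsq_comb; ring.
by rewrite pmulr_rge0// subr_ge0.
Qed.

Lemma derive_grad g x v : differentiable g x -> 'D_v g x = dot (grad g x) v.
Proof.
move=> dg; rewrite deriveE// {1}(row_sum_delta v) linear_sum /dot.
by apply: eq_bigr => i _; rewrite linearZ /= mxE deriveE// mulrC.
Qed.

Lemma is_derive_line g x v (t : R) : (forall z, differentiable g z) ->
  is_derive t (1 : R) (fun s : R => g (x + s *: v)) (dot (grad g (x + t *: v)) v).
Proof.
move=> dg; have dv : derivable g (x + t *: v) v by exact: diff_derivable.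
have E : (fun h : R => h^-1 *: ((fun s : R => g (x + s *: v)) (h *: 1 + t)
            - g (x + t *: v))) =
         (fun h : R => h^-1 *: (g (h *: v + (x + t *: v)) - g (x + t *: v))).
  apply/funext => h; congr (_ *: (g _ - _)).
  by rewrite [h *: 1]mulr1 scalerDl addrCA.
apply: DeriveDef; first by rewrite /derivable /= E.
by rewrite -derive_grad// /derive /= E.
Qed.

(** The mean value theorem gives g y - g x = <grad g z, v> with v = y - x and
    z on the segment; the Young inequality and the Lipschitz bound give <grad
    g z - grad g x, v> <= Lam |v|^2. With Lam in place of Lam / 2, no
    integration along the segment is needed. *)
Lemma descent g (Lam : R) x y : (forall z, differentiable g z) -> 1 <= Lam ->
  (forall z z', nsq (grad g z - grad g z') <= Lam * nsq (z - z')) ->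
  g y <= g x + dot (grad g x) (y - x) + Lam * nsq (y - x).
Proof.
move=> dg Lam1 g_lip; set v := y - x.
have [] := @MVT_segment R (fun s : R => g (x + s *: v))
  (fun s => dot (grad g (x + s *: v)) v) 0 1 ler01.
- by move=> t _; exact: is_derive_line.
- apply: continuous_subspaceT => t.
  apply: differentiable_continuous; apply/derivable1_diffP.
  by have [] := is_derive_line x v t dg.
move=> t; rewrite in_itv /= => /andP[t0 t1].
rewrite scale0r addr0 scale1r subr0 mulr1 (_ : x + v = y); last first.
  by rewrite /v addrC subrK.
move=> gE.
have -> : g y = g x + dot (grad g (x + t *: v)) v by rewrite -gE addrC subrK.
rewrite -addrA lerD2l -lerBlDl.
have -> : dot (grad g (x + t *: v)) v - dot (grad g x) v =
          dot (grad g (x + t *: v) - grad g x) v.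
  by rewrite /dot -sumrB; apply: eq_bigr => i _; rewrite !mxE mulrBl.
have := dot_le (grad g (x + t *: v) - grad g x) v.
have := g_lip (x + t *: v) x; rewrite [x + _ - x]addrC addKr nsqZ.
have t21 : t ^+ 2 <= 1 by rewrite expr_le1.
have := ler_wpM2r (nsq_ge0 v) t21; rewrite mul1r.
have := nsq_ge0 v; set N := nsq v; set Q := t ^+ 2 * N => *.
have : Lam * Q <= Lam * N by rewrite ler_wpM2l//; lra.
have : N <= Lam * N by rewrite ler_peMl.
by lra.
Qed.

End Descent.

(** * Increments of real powers *)

Section Steps.
Context (R : realType).
Implicit Types (p s r q : R).

(** Comparison of a term of a sum with the integral of t^(-r-1) over [p, s],
    obtained from 1 + y <= exp y instead of integration. *)
Lemma powR_increment p s r : 0 < r -> 0 < p -> p <= s ->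
  (s - p) * s `^ (- r - 1) <= (p `^ (- r) - s `^ (- r)) / r.
Proof.
move=> r0 p0 ps; have s0 : 0 < s := lt_le_trans p0 ps.
rewrite ler_pdivlMr//.
have -> : s `^ (- r - 1) = s `^ (- r) / s.
  by rewrite powRD ?powR_inv1 ?(ltW s0)//; apply/implyP => _; rewrite gt_eqF.
have sr : 0 < s `^ (- r) by exact: powR_gt0.
have -> : p `^ (- r) = s `^ (- r) * expR (r * (ln s - ln p)).
  rewrite /powR !gt_eqF// -expRD; congr expR; ring.
(* 1 + y <= exp y is used twice: here at y = ln (p / s), and below at y = r
   (ln s - ln p). *)
have ln_le : 1 - p / s <= ln s - ln p.
  have ps0 : 0 < p / s by exact: divr_gt0.
  have := expR_ge1Dx (ln (p / s)); rewrite lnK ?posrE// ln_div ?posrE//.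
  by lra.
have := expR_ge1Dx (r * (ln s - ln p)).
have : r * (1 - p / s) <= r * (ln s - ln p) by rewrite ler_wpM2l// ltW.
have -> : (s - p) * (s `^ (- r) / s) * r = s `^ (- r) * (r * (1 - p / s)).
  by field; rewrite gt_eqF.
move=> le1 le2; set e := expR _ in le2 *.
have -> : s `^ (- r) * e - s `^ (- r) = s `^ (- r) * (e - 1) by ring.
by apply: ler_wpM2l; [exact: ltW|lra].
Qed.

Lemma powRN_le p s q : 0 <= q -> 0 < p -> p <= s -> s `^ (- q) <= p `^ (- q).
Proof.
move=> q0 p0 ps; rewrite !powRN lef_pV2 ?posrE ?powR_gt0 ?(lt_le_trans p0)//.
by apply: ge0_ler_powR => //; rewrite nnegrE ltW// (lt_le_trans p0).
Qed.

End Steps.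
(** * One trajectory of the recursion *)

Section Path.
Context (R : realType) (d : nat) (g : 'rV[R]_d -> R) (Lam q alpha0 K : R).
Context (x G : nat -> 'rV[R]_d) (S : nat -> R).
Hypothesis Lam_ge1 : 1 <= Lam.
Hypothesis K_ge1 : 1 <= K.
Hypothesis q_gt : 2^-1 < q.
Hypothesis alpha0_gt0 : 0 < alpha0.
Hypothesis g_diff : forall z, differentiable g z.
Hypothesis g_lip : forall z z',
  nsq (grad g z - grad g z') <= Lam * nsq (z - z').
Hypothesis S0_gt0 : 0 < S 0.
Hypothesis S_rec : forall n, S n.+1 = S n + nsq (G n).
Hypothesis x_rec : forall n,
  x n.+1 = x n - (alpha0 * S n.+1 `^ (- q)) *: G n.

(** Known before [G n] is drawn; the step out of [x n] has size [rate n.+1].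
    *)
Definition rate n := alpha0 * S n `^ (- q).
Definition gsq n := nsq (grad g (x n)).
(** The potential that pays for the second-order terms: since 2 q > 1, the
    sum of S^(-2q) dS telescopes through S^(1-2q). *)
Definition decay n := S n `^ (- (2 * q - 1)).
Definition step_scale := alpha0 ^+ 2 / (2 * q - 1).
(** The objective plus two decreasing quantities: the step size pays for
    replacing the current step size by the previous one, and [decay] pays for
    the second-order term of the descent inequality. *)
Definition potential n :=
  g (x n) + K / 2 * rate n + Lam * step_scale * decay n.

Lemma S_le n : S n <= S n.+1.
Proof. by rewrite S_rec lerDl nsq_ge0. Qed.

Lemma S_ge n : S 0 <= S n.
Proof. by elim: n => // n IH; exact: le_trans (S_le n). Qed.

Lemma S_gt0 n : 0 < S n.
Proof. exact: lt_le_trans (S_ge n). Qed.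

Lemma rate_gt0 n : 0 < rate n.
Proof. by rewrite mulr_gt0// powR_gt0// S_gt0. Qed.

Lemma rate_le n : rate n.+1 <= rate n.
Proof.
rewrite ler_wpM2l ?(ltW alpha0_gt0)//; apply: powRN_le (S_gt0 n) (S_le n).
by have := q_gt; lra.
Qed.

Lemma rate_le0 n : rate n <= rate 0.
Proof. by elim: n => // n IH; exact: le_trans (rate_le n) IH. Qed.

Lemma gsq_ge0 n : 0 <= gsq n.
Proof. exact: nsq_ge0. Qed.

Lemma decay_ge0 n : 0 <= decay n.
Proof. exact: powR_ge0. Qed.

Lemma decay_le n : decay n.+1 <= decay n.
Proof.
by apply: powRN_le (S_gt0 n) (S_le n); have := q_gt; lra.
Qed.

Lemma decay_le0 n : decay n <= decay 0.
Proof. by elim: n => // n IH; exact: le_trans (decay_le n) IH. Qed.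

Lemma step_scale_ge0 : 0 <= step_scale.
Proof.
rewrite /step_scale divr_ge0 ?sqr_ge0//.
by have := q_gt; lra.
Qed.

Lemma step_sqr_le n :
  rate n.+1 ^+ 2 * nsq (G n) <= step_scale * (decay n - decay n.+1).
Proof.
have r0 : 0 < 2 * q - 1 by have := q_gt; lra.
have := powR_increment r0 (S_gt0 n) (S_le n).
rewrite -/(decay n) -/(decay n.+1) {1}S_rec addrAC subrr add0r => le1.
rewrite /step_scale -mulrA [_^-1 * _]mulrC.
have -> : rate n.+1 ^+ 2 * nsq (G n) =
    alpha0 ^+ 2 * (nsq (G n) * S n.+1 `^ (- (2 * q - 1) - 1)).
  rewrite /rate exprMn -mulrA; congr (_ * _); rewrite mulrC; congr (_ * _).
  have -> : - (2 * q - 1) - 1 = - q + - q by ring.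
  by rewrite powRD ?expr2//; apply/implyP => _; rewrite gt_eqF// S_gt0.
by rewrite ler_wpM2l ?sqr_ge0.
Qed.

(** Squared steps have a deterministic bound, hence so has each iterate. The
    bound explodes with [n], but it makes g and its gradient bounded random
    variables at each fixed time, so that every mean below exists. *)
Lemma iterate_bounded n :
  nsq (x n - x 0) <= 4 ^+ n * (step_scale * decay 0).
Proof.
have c0 : 0 <= step_scale * decay 0.
  by rewrite mulr_ge0 ?step_scale_ge0 ?decay_ge0.
elim: n => [|n IH].
  by rewrite subrr expr0 mul1r /nsq big1// => i _; rewrite mxE expr0n.
rewrite x_rec -/(rate n.+1) addrAC; apply: (le_trans (nsqD_le _ _)).
rewrite nsqN nsqZ.
have step : rate n.+1 ^+ 2 * nsq (G n) <= step_scale * decay 0.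
  apply: (le_trans (step_sqr_le n)); rewrite ler_wpM2l ?step_scale_ge0//.
  by have := decay_le0 n; have := decay_ge0 n.+1; lra.
have p1 : 1 <= 4 ^+ n :> R by rewrite exprn_ege1// ler1n.
move: IH step; rewrite (exprS 4); set c := step_scale * decay 0.
set p := (4 ^+ n : R); set y := nsq _; set z := _ * nsq _ => IH step.
have : c <= p * c by rewrite ler_peMl.
by lra.
Qed.

Lemma gsq_lip n m : gsq n <= 2 * gsq m + 2 * Lam * nsq (x n - x m).
Proof.
have := nsqD_le (grad g (x n) - grad g (x m)) (grad g (x m)).
by rewrite subrK -/(gsq n) -/(gsq m); have := g_lip (x n) (x m); lra.
Qed.

Lemma gsq_bounded n :
  gsq n <= 2 * gsq 0 + 2 * Lam * (4 ^+ n * (step_scale * decay 0)).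
Proof.
apply: (le_trans (gsq_lip n 0)); rewrite lerD2l.
by rewrite ler_wpM2l ?iterate_bounded// mulr_ge0// (le_trans ler01).
Qed.

Lemma g_bounded n :
  g (x n) <= g (x 0) + gsq 0 + 2 * Lam * (4 ^+ n * (step_scale * decay 0)).
Proof.
apply: (le_trans (descent (x 0) (x n) g_diff Lam_ge1 g_lip)).
have := dot_le (grad g (x 0)) (x n - x 0); rewrite -/(gsq 0).
have := iterate_bounded n; have := nsq_ge0 (x n - x 0); have := gsq_ge0 0.
set N := nsq _; set c := _ * (_ * _) => g0 N0 Nc dle.
have : N <= Lam * N by rewrite ler_peMl.
have : Lam * N <= Lam * c by rewrite ler_wpM2l// (le_trans ler01).
by lra.
Qed.

(** The step size [rate n.+1] depends on the gradient [G n]. Write a' = a -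
    (a - a') with a = [rate n]: the first part can be averaged. For the
    second one, t = <grad g, G> satisfies t <= t^2 / (2 K) + K / 2.
    Multiplied by a - a', the constant K / 2 gives a telescoping term, and
    the square is at most a t^2 / (2 K) because a - a' <= a; its conditional
    mean is at most half of a |grad g|^2 when the conditional second moment
    of [G n] is at most [K]. *)
Lemma potential_step n :
  potential n.+1 <= potential n - rate n * dot (grad g (x n)) (G n)
                    + rate n * gsq n * nsq (G n) / (2 * K).
Proof.
have := descent (x n) (x n.+1) g_diff Lam_ge1 g_lip.
have vE i : (x n.+1 - x n) 0 i = - rate n.+1 * G n 0 i.
  by rewrite x_rec !mxE -/(rate n.+1); ring.
have -> : dot (grad g (x n)) (x n.+1 - x n) =
          - rate n.+1 * dot (grad g (x n)) (G n).
  by rewrite /dot mulr_sumr; apply: eq_bigr => i _; rewrite vE mulrCA.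
have -> : nsq (x n.+1 - x n) = rate n.+1 ^+ 2 * nsq (G n).
  by rewrite /nsq mulr_sumr; apply: eq_bigr => i _; rewrite vE exprMn sqrrN.
have K0 : 0 < K := lt_le_trans ltr01 K_ge1.
have Lam0 : 0 <= Lam := le_trans ler01 Lam_ge1.
have := ler_wpM2l Lam0 (step_sqr_le n).
have := dot_sqr_le (grad g (x n)) (G n); rewrite -/(gsq n).
have := rate_le n; have := rate_gt0 n; have := rate_gt0 n.+1.
rewrite /potential.
move: (rate n) (rate n.+1) => a a' a'0 a0 a'a.
set t := dot _ _; set B := gsq n * nsq (G n) => tB step desc.
have amgm : (a - a') * t <= a * B / (2 * K) + K / 2 * (a - a').
  have t_le : t <= t ^+ 2 / (2 * K) + K / 2.
    have -> : t ^+ 2 / (2 * K) + K / 2 = (t ^+ 2 + K ^+ 2) / (2 * K).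
      by field; rewrite gt_eqF.
    by rewrite ler_pdivlMr ?mulr_gt0//; have := sqr_ge0 (t - K); lra.
  have t2 : t ^+ 2 / (2 * K) <= B / (2 * K).
    by rewrite ler_wpM2r// invr_ge0 mulr_ge0// ltW.
  have tK : 0 <= t ^+ 2 / (2 * K) by rewrite divr_ge0 ?sqr_ge0// mulr_ge0// ltW.
  have : (a - a') * t <= (a - a') * (t ^+ 2 / (2 * K) + K / 2).
    by rewrite ler_wpM2l// subr_ge0.
  have : (a - a') * (t ^+ 2 / (2 * K)) <= a * (B / (2 * K)).
    apply: ler_pM => //; first by rewrite subr_ge0.
    by rewrite gerBl ltW.
  by rewrite -mulrA; lra.
have -> : a * gsq n * nsq (G n) / (2 * K) = a * B / (2 * K).
  by rewrite /B; field; rewrite gt_eqF.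
move: step desc amgm; rewrite !mulrA; lra.
Qed.

(** For q <= 1 the step size is at least a multiple of 1 / S, and 1 / S >= 2
    t - t^2 S for every t. This bound is affine in S, so it can be averaged
    knowing only the mean of S. *)
Lemma rate_ge n t : q <= 1 ->
  alpha0 * S 0 `^ (1 - q) * (2 * t - t ^+ 2 * S n) <= rate n.
Proof.
move=> q1; rewrite /rate -mulrA ler_wpM2l ?(ltW alpha0_gt0)//.
have Sn0 := S_gt0 n.
have -> : S n `^ (- q) = S n `^ (1 - q) / S n.
  rewrite addrC powRD; last by apply/implyP => _; rewrite gt_eqF.
  by rewrite powRr1 ?(ltW Sn0)// mulfK// gt_eqF.
rewrite ler_pdivlMr//.
have pS : S 0 `^ (1 - q) <= S n `^ (1 - q).
  apply: ge0_ler_powR; rewrite ?subr_ge0// ?nnegrE ?(ltW Sn0) ?(ltW S0_gt0)//.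
  exact: S_ge.
apply: (le_trans _ pS); rewrite -mulrA ler_piMr ?powR_ge0//.
by have := sqr_ge0 (1 - t * S n); nra.
Qed.

(** Being at most gsq / e, this indicator charges the time spent above [e] to
    the summable quantity a |grad g|^2. *)
Definition above (e : R) n : R := (e <= gsq n)%R%:R.

Lemma above_le e n : 0 < e -> above e n <= gsq n / e.
Proof.
move=> e0; rewrite ler_pdivlMr// /above; case: (leP e (gsq n)) => en.
  by rewrite mul1r.
by rewrite mul0r gsq_ge0.
Qed.

(** A bound on the predictable and correction parts of one step taken above
    level [e]; see [move_above_le]. *)
Definition drift (e : R) j : R :=
  (e^-1 + 1) * (rate j * gsq j) + e^-1 * (rate j * gsq j * nsq (G j))
  + (rate j - rate j.+1).

(** The centred part of coordinate [i] of a step taken above level [e],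
    counted from time [n] on. *)
Definition fluct (e : R) n i j : R :=
  (n <= j)%:R * above e j * rate j * (G j 0 i - grad g (x j) 0 i).

(** While the squared gradient stays above [e], a step is a' G = a (G - grad
    g) + a grad g - (a - a') G. The first part is [fluct]. The others are
    summable because each is multiplied by the indicator [above]: |grad g| <=
    1 + gsq, |G| <= 1 + |G|^2, and the indicator is at most gsq / e. *)
Lemma move_above_le e n m i : 0 < e -> (n <= m)%N ->
  (forall j, (n <= j < m)%N -> e <= gsq j) ->
  `|x n 0 i - x m 0 i| <= `|psum (fluct e n i) m|
                          + \sum_(j < m) (n <= j)%:R * drift e j.
Proof.
move=> e0 nm ab.
have mv k : (n <= k <= m)%N -> x n 0 i - x k 0 i =
    psum (fluct e n i) k + \sum_(j < k) (n <= j)%:R *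
      (above e j * (rate j * grad g (x j) 0 i - (rate j - rate j.+1) * G j 0 i)).
  elim: k => [|k IH].
    rewrite leqn0 => /andP[/eqP -> _].
    by rewrite /psum !big_ord0 subrr addr0.
  rewrite leq_eqVlt => /andP[/predU1P[<- _|]].
    rewrite subrr /psum -big_split /= big1// => j _.
    by rewrite /fluct leqNgt ltn_ord /= !mul0r addr0.
  rewrite ltnS => nk km; have ek : e <= gsq k by apply: ab; rewrite nk.
  have {}IH := IH (introT andP (conj nk (ltnW km))).
  have abk : above e k = 1 by rewrite /above ek.
  have xk : x k.+1 0 i = x k 0 i - rate k.+1 * G k 0 i by rewrite x_rec !mxE.
  rewrite psumS big_ord_recr /= xk.
  rewrite {2}/fluct nk abk !mul1r.
  have -> : x k 0 i = x n 0 i - (x n 0 i - x k 0 i) by ring.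
  by rewrite IH; ring.
rewrite mv ?nm ?leqnn//; apply: (le_trans (ler_normD _ _)); rewrite lerD2l.
apply: (le_trans (ler_norm_sum _ _ _)); apply: ler_sum => j _.
rewrite normrM ger0_norm// ler_wpM2l//.
rewrite /drift.
have := above_le j e0; have := gsq_ge0 j.
have := rate_le j; have := rate_gt0 j; have := rate_gt0 j.+1.
have ui : grad g (x j) 0 i ^+ 2 <= gsq j.
  by rewrite /gsq /nsq (bigD1 i)//= lerDl sumr_ge0// => k _; exact: sqr_ge0.
have Gi : G j 0 i ^+ 2 <= nsq (G j).
  by rewrite /nsq (bigD1 i)//= lerDl sumr_ge0// => k _; exact: sqr_ge0.
move: (rate j) (rate j.+1) (gsq j) (nsq (G j)) ui Gi => a a' b G2.
move: (G j 0 i) (grad g (x j) 0 i) => Gi u u2 Gi_le a'0 a0 a'a b0 ab_le.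
have ei : 0 < e^-1 by rewrite invr_gt0.
have G20 : 0 <= G2 := le_trans (sqr_ge0 _) Gi_le.
rewrite mulrBr (le_trans (ler_normB _ _))//.
have Ib : above e j <= b * e^-1 := ab_le.
have I01 : 0 <= above e j <= 1 by rewrite /above ler0n lern1 leq_b1.
move: (above e j) Ib I01 => I Ib /andP[I0 I1].
have t1 : `|I * (a * u)| <= (e^-1 + 1) * (a * b).
  rewrite !normrM (ger0_norm I0) (gtr0_norm a0).
  have uu : `|u| <= 1 + u ^+ 2.
    by rewrite -[u ^+ 2]real_normK ?num_real//; have := sqr_ge0 (`|u| - 1); nra.
  have Iu : I * `|u| <= I * (1 + b) by rewrite ler_wpM2l//; lra.
  have IB : I * b <= b by rewrite ler_piMl.
  have : a * (I * `|u|) <= a * ((e^-1 + 1) * b) by rewrite ler_wpM2l ?(ltW a0)//; lra.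
  by rewrite mulrCA => h; rewrite [leRHS]mulrCA.
have t2 : `|I * ((a - a') * Gi)| <= e^-1 * (a * b * G2) + (a - a').
  rewrite !normrM (ger0_norm I0) (@ger0_norm _ (a - a')) ?subr_ge0//.
  have uu : `|Gi| <= G2 + 1.
    apply: (le_trans _ (_ : Gi ^+ 2 + 1 <= _)); last by lra.
    by rewrite -[Gi ^+ 2]real_normK ?num_real//; have := sqr_ge0 (`|Gi| - 1); nra.
  have D0 : 0 <= a - a' by rewrite subr_ge0.
  have s1 : I * ((a - a') * `|Gi|) <= I * ((a - a') * (G2 + 1)).
    by rewrite ler_wpM2l// ler_wpM2l.
  have s2 : I * ((a - a') * G2) <= (b * e^-1) * (a * G2).
    apply: ler_pM => //; first exact: mulr_ge0.
    by rewrite ler_wpM2r// gerBl ltW.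
  have s3 : I * (a - a') <= a - a' by rewrite ler_piMl.
  have -> : e^-1 * (a * b * G2) = b * e^-1 * (a * G2) by ring.
  by move: s1; rewrite mulrDr mulr1 mulrDr; lra.
by lra.
Qed.

Lemma drift_ge0 e j : 0 < e -> 0 <= drift e j.
Proof.
move=> e0; have ei : 0 <= e^-1 by rewrite invr_ge0 ltW.
have r0 := ltW (rate_gt0 j).
have ab0 : 0 <= rate j * gsq j by rewrite mulr_ge0// gsq_ge0.
rewrite addr_ge0 ?subr_ge0 ?rate_le// addr_ge0//.
  by rewrite mulr_ge0// addr_ge0.
by rewrite mulr_ge0// mulr_ge0// nsq_ge0.
Qed.

Definition excursion e n M i : R :=
  runmax (psum (fluct e n i)) M + runmax (psum (fun j => - fluct e n i j)) M
  + \sum_(j < M) (n <= j)%:R * drift e j.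

(** The bound no longer depends on the time [m] at which the path is stopped,
    only on the horizon [M]. *)
Lemma norm_move_le_excursion e n m M i : 0 < e -> (n <= m <= M)%N ->
  (forall j, (n <= j < m)%N -> e <= gsq j) ->
  `|x n 0 i - x m 0 i| <= excursion e n M i.
Proof.
move=> e0 /andP[nm mM] ab; apply: (le_trans (move_above_le i e0 nm ab)).
set D := fluct e n i.
have rD : psum D m <= runmax (psum D) M by exact: runmax_ge.
have rN : - psum D m <= runmax (psum (fun j => - D j)) M.
  by rewrite /psum -sumrN; exact: (runmax_ge (psum (fun j => - D j)) mM).
have rD0 : 0 <= runmax (psum D) M.
  by have := runmax_ge (psum D) (leq0n M); rewrite {1}/psum big_ord0.
have rN0 : 0 <= runmax (psum (fun j => - D j)) M.
  by have := runmax_ge (psum (fun j => - D j)) (leq0n M); rewrite {1}/psum big_ord0.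
apply: lerD; first by rewrite ler_norml; lra.
rewrite -(big_mkord xpredT (fun j => (n <= j)%:R * drift e j)).
rewrite -(big_mkord xpredT (fun j => (n <= j)%:R * drift e j)).
rewrite (big_cat_nat _ mM)//= lerDl sumr_ge0// => j _.
by rewrite mulr_ge0// drift_ge0.
Qed.

(** If the squared gradient is at least 4 e at time [n], then either it stays
    above e up to the horizon, or at its first passage below e the iterate
    has moved by at least kappa, because the gradient is Lipschitz. The
    choice e = Lam kappa^2 makes the two thresholds match. *)
Lemma high_gradient_le kappa n M (e := Lam * kappa ^+ 2) :
  0 < kappa -> (n <= M)%N ->
  (4 * e <= gsq n)%R%:R <=
    kappa^-1 * \sum_(i < d) excursion e n M i + \prod_(n <= j < M) above e j.
Proof.
move=> k0 nM.
have e0 : 0 < e by rewrite mulr_gt0 ?exprn_gt0// (lt_le_trans ltr01).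
have above01 j : 0 <= above e j by rewrite /above ler0n.
have prod0 : 0 <= \prod_(n <= j < M) above e j by exact: prodr_ge0.
have exc0 i : 0 <= excursion e n M i.
  have := @norm_move_le_excursion e n n M i e0.
  rewrite leqnn nM subrr normr0; apply=> // j.
  by rewrite ltnNge andbN.
have [bn|_] := leP (4 * e) (gsq n); last first.
  by rewrite addr_ge0// mulr_ge0 ?invr_ge0 ?sumr_ge0// ltW.
have [allab|] := boolP (all (fun j => e <= gsq j) (index_iota n M)).
  rewrite [X in _ <= _ + X](_ : _ = 1); last first.
    rewrite big_seq big1// => j jnM; rewrite /above.
    by move/allP: allab => /(_ j jnM) ->.
  by rewrite lerDr mulr_ge0 ?invr_ge0 ?sumr_ge0// ltW.
rewrite -has_predC => /hasP[m0 m0nM /= bm0].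
have ex : exists m, (n <= m < M)%N && ~~ (e <= gsq m).
  by exists m0; rewrite -mem_index_iota m0nM.
case: (ex_minnP ex) => m /andP[/andP[nm mM] bm] minm.
have ab j : (n <= j < m)%N -> e <= gsq j.
  move=> /andP[nj jm]; apply: contraT => bj.
  have := minm j; rewrite nj (ltn_trans jm mM) bj => /(_ isT).
  by rewrite leqNgt jm.
have Sle : \sum_(i < d) `|(x n - x m) 0 i| <= \sum_(i < d) excursion e n M i.
  apply: ler_sum => i _; rewrite !mxE.
  by apply: norm_move_le_excursion ab => //; rewrite nm ltnW.
rewrite -ltNge in bm.
have k2 : kappa ^+ 2 <= nsq (x n - x m).
  rewrite -(ler_pM2l (lt_le_trans ltr01 Lam_ge1)) -/e.
  by have := gsq_lip n m; lra.
have kS : kappa <= \sum_(i < d) `|(x n - x m) 0 i|.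
  have s0 : 0 <= \sum_(i < d) `|(x n - x m) 0 i| by exact: sumr_ge0.
  rewrite -ler_sqr ?nnegrE ?(ltW k0)//.
  exact: le_trans k2 (nsq_le_norm1 _).
rewrite -[leLHS]addr0 lerD// mulrC ler_pdivlMr// mul1r.
exact: le_trans Sle.
Qed.

End Path.
Lemma sum_decrements (R : realType) (f : nat -> R) n :
  \sum_(j < n) (f j - f j.+1) = f 0%N - f n.
Proof.
elim: n => [|n IH]; first by rewrite big_ord0 subrr.
by rewrite big_ord_recr /= IH addrA subrK.
Qed.

(** * Bounded adapted weights *)

Section BoundedAdapted.
Context (R : realType) (disp : measure_display) (T : measurableType disp)
  (P : probability T R) (F : nat -> set (set T)).
Hypothesis F_filtration : filtration F.

(** Such weights keep integrable variables integrable and square-integrable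
    ones square-integrable, which settles integrability for every weight
    below except the running maximum of the maximal inequality. *)
Definition bounded_adapted n (Z : T -> R) :=
  measurable_wrt (F n) Z /\ exists c, forall w, `|Z w| <= c.

Lemma bounded_adapted_measurable n Z :
  bounded_adapted n Z -> measurable_fun [set: T] Z.
Proof.
by have [sF FT _] := F_filtration; move=> [mZ _]; exact: measurable_wrt_fun mZ.
Qed.

Lemma bounded_adapted_L2 n Z : bounded_adapted n Z -> L2 P Z.
Proof.
move=> bZ; have [_ [c Zc]] := bZ; apply: L2_bounded Zc.
exact: bounded_adapted_measurable bZ.
Qed.

Lemma bounded_adapted_L1 n Z : bounded_adapted n Z -> L1 P Z.
Proof. by move=> bZ; apply/L2_L1/bounded_adapted_L2/bZ. Qed.

Lemma bounded_adapted_mul_L1 n Z f :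
  bounded_adapted n Z -> L1 P f -> L1 P (fun w => Z w * f w).
Proof.
move=> bZ; have [_ [c Zc]] := bZ; apply: L1_mul_bounded Zc.
exact: bounded_adapted_measurable bZ.
Qed.

Lemma bounded_adapted_mul_L2 n Z f :
  bounded_adapted n Z -> L2 P f -> L2 P (fun w => Z w * f w).
Proof.
move=> bZ; have [_ [c Zc]] := bZ; apply: L2_mul_bounded Zc.
exact: bounded_adapted_measurable bZ.
Qed.

Lemma bounded_adapted_cst n c : bounded_adapted n (fun=> c).
Proof. by split; [exact: measurable_cst|exists `|c|]. Qed.

Lemma bounded_adaptedD n Z Z' : bounded_adapted n Z -> bounded_adapted n Z' ->
  bounded_adapted n (fun w => Z w + Z' w).
Proof.
move=> [mZ [c Zc]] [mZ' [c' Zc']]; split; first exact: measurable_funD.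
by exists (c + c') => w; rewrite (le_trans (ler_normD _ _))// lerD.
Qed.

Lemma bounded_adaptedM n Z Z' : bounded_adapted n Z -> bounded_adapted n Z' ->
  bounded_adapted n (fun w => Z w * Z' w).
Proof.
move=> [mZ [c Zc]] [mZ' [c' Zc']]; split; first exact: measurable_funM.
by exists (c * c') => w; rewrite normrM ler_pM.
Qed.

Lemma bounded_adaptedZ n c Z : bounded_adapted n Z ->
  bounded_adapted n (fun w => c * Z w).
Proof. by apply: bounded_adaptedM; exact: bounded_adapted_cst. Qed.

Lemma bounded_adaptedX n k Z : bounded_adapted n Z ->
  bounded_adapted n (fun w => Z w ^+ k).
Proof.
move=> [mZ [c Zc]]; split; first exact: measurable_funX.
exists (c ^+ k) => w; rewrite normrX; apply: lerXn2r => //.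
by rewrite nnegrE (le_trans _ (Zc w)).
Qed.

Lemma bounded_adapted_sum n I (s : seq I) (Z : I -> T -> R) :
  (forall i, bounded_adapted n (Z i)) ->
  bounded_adapted n (fun w => \sum_(i <- s) Z i w).
Proof.
move=> bZ; elim: s => [|i s IH].
  have -> : (fun w => \sum_(i <- [::]) Z i w) = (fun=> 0).
    by apply/funext => w; rewrite big_nil.
  exact: bounded_adapted_cst.
have -> : (fun w => \sum_(j <- i :: s) Z j w) =
          (fun w => Z i w + \sum_(j <- s) Z j w).
  by apply/funext => w; rewrite big_cons.
exact: bounded_adaptedD.
Qed.

End BoundedAdapted.

(** * Mean bounds along the recursion *)

Section Stochastic.
Context (R : realType) (disp : measure_display) (T : measurableType disp)
  (P : probability T R) (F : nat -> set (set T)).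
Context (d : nat) (g : 'rV[R]_d -> R) (Lam q alpha0 K s0 : R) (x1 : 'rV[R]_d).
Context (x G : nat -> T -> 'rV[R]_d) (S : nat -> T -> R).
Hypothesis F_filtration : filtration F.
Hypothesis Lam_ge1 : 1 <= Lam.
Hypothesis K_ge1 : 1 <= K.
Hypothesis q_gt : 2^-1 < q.
Hypothesis alpha0_gt0 : 0 < alpha0.
Hypothesis s0_gt0 : 0 < s0.
Hypothesis g_ge0 : forall z, 0 <= g z.
Hypothesis g_diff : forall z, differentiable g z.
Hypothesis g_lip : forall z z',
  nsq (grad g z - grad g z') <= Lam * nsq (z - z').
Hypothesis S_init : forall w, S 0 w = s0.
Hypothesis x_init : forall w, x 0 w = x1.
Hypothesis S_rec : forall w n, S n.+1 w = S n w + nsq (G n w).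
Hypothesis x_rec : forall w n,
  x n.+1 w = x n w - (alpha0 * S n.+1 w `^ (- q)) *: G n w.
Hypothesis S_adapted : forall n, measurable_wrt (F n) (S n).
Hypothesis g_adapted : forall n, measurable_wrt (F n) (fun w => g (x n w)).
Hypothesis grad_adapted : forall n i,
  measurable_wrt (F n) (fun w => grad g (x n w) 0 i).
Hypothesis G_adapted : forall n i,
  measurable_wrt (F n.+1) (fun w => G n w 0 i).
Hypothesis G_L1 : forall n, L1 P (fun w => nsq (G n w)).
Hypothesis G_unbiased : forall n i A, F n A ->
  mean P (fun w => \1_A w * (G n w 0 i - grad g (x n w) 0 i)) = 0.
Hypothesis G_second_moment : forall n (Z : T -> R) c, measurable_wrt (F n) Z ->
  (forall w, 0 <= Z w <= c) ->
  mean P (fun w => Z w * nsq (G n w)) <= K * mean P Z.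

Local Notation a n w := (rate q alpha0 (S^~ w) n).
Local Notation b n w := (gsq g (x^~ w) n).
Local Notation u n i w := (grad g (x n w) 0 i).
Local Notation gam n w := (nsq (G n w)).
Local Notation adb := (bounded_adapted F).

Let sF n : sigma_algebra [set: T] (F n).
Proof. by case: F_filtration. Qed.
Let FT n : F n `<=` @measurable disp T.
Proof. by case: F_filtration. Qed.
Let S0_gt0 w : 0 < S 0 w. Proof. by rewrite S_init. Qed.
Let Lam0 : 0 < Lam. Proof. exact: lt_le_trans ltr01 Lam_ge1. Qed.
Let K0 : 0 < K. Proof. exact: lt_le_trans ltr01 K_ge1. Qed.

Definition rate0 := alpha0 * s0 `^ (- q).

Lemma rate_le_rate0 n w : a n w <= rate0.
Proof.
have := rate_le0 q_gt alpha0_gt0 (S0_gt0 w) (S_rec w) n.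
by rewrite [X in _ <= X]/rate S_init.
Qed.

Lemma rate_pos n w : 0 < a n w.
Proof. exact: (rate_gt0 q alpha0_gt0 (S0_gt0 w) (S_rec w)). Qed.

Lemma rate_adb n : adb n (fun w => a n w).
Proof.
split.
  apply: measurable_funM => //.
  have mS : measurable_fun [set: g_sigma_algebraType (F n)]
    (S n : g_sigma_algebraType (F n) -> R) by exact: S_adapted.
  exact: measurableT_comp (measurable_powR (- q)) mS.
exists rate0 => w; rewrite gtr0_norm ?rate_pos//; exact: rate_le_rate0.
Qed.

Lemma gsq_adb n : adb n (fun w => b n w).
Proof.
split.
  by apply: measurable_sum => i; apply: measurable_funX; exact: grad_adapted.
have [c E] : exists c, forall w, 2 * gsq g (x^~ w) 0 + 2 * Lam *
    (4 ^+ n * (step_scale q alpha0 * decay q (S^~ w) 0)) = c.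
  eexists => w; rewrite /gsq /decay x_init S_init; reflexivity.
exists c => w; rewrite ger0_norm ?gsq_ge0// -(E w).
exact: (gsq_bounded Lam_ge1 q_gt g_lip (S0_gt0 w) (S_rec w) (x_rec w)).
Qed.

Lemma g_adb n : adb n (fun w => g (x n w)).
Proof.
split; first exact: g_adapted.
have [c E] : exists c, forall w, g (x 0 w) + gsq g (x^~ w) 0 + 2 * Lam *
    (4 ^+ n * (step_scale q alpha0 * decay q (S^~ w) 0)) = c.
  eexists => w; rewrite /gsq /decay x_init S_init; reflexivity.
exists c => w; rewrite ger0_norm// -(E w).
exact: (g_bounded Lam_ge1 q_gt g_diff g_lip (S0_gt0 w) (S_rec w) (x_rec w)).
Qed.

Lemma grad_adb n i : adb n (fun w => u n i w).
Proof.
split; first exact: grad_adapted.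
have [_ [c bc]] := gsq_adb n; exists (1 + c) => w.
have ui : u n i w ^+ 2 <= b n w.
  by rewrite /gsq /nsq (bigD1 i)//= lerDl sumr_ge0// => k _; exact: sqr_ge0.
have := bc w; rewrite ger0_norm ?gsq_ge0//.
move: ui; rewrite -[u n i w ^+ 2]real_normK ?num_real//.
by have := sqr_ge0 (`|u n i w| - 1); nra.
Qed.

Lemma grad_noise_L2 n i : L2 P (fun w => G n w 0 i - u n i w).
Proof.
apply: L2B; last exact: bounded_adapted_L2 (grad_adb n i).
have mG : measurable_fun [set: T] (fun w => G n w 0 i).
  exact: (measurable_wrt_fun (sF n.+1) (@FT n.+1) (@G_adapted n i)).
split=> //; apply: (L1_dominated _ (G_L1 n)); first exact: measurable_funX.
move=> w; rewrite ger0_norm ?sqr_ge0//.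
by rewrite /nsq (bigD1 i)//= lerDl sumr_ge0// => k _; exact: sqr_ge0.
Qed.

Lemma grad_noise_centred n i (Z : T -> R) : measurable_wrt (F n) Z -> L2 P Z ->
  mean P (fun w => Z w * (G n w 0 i - u n i w)) = 0.
Proof.
move=> mZ sZ; apply: (mean_mul_eq0 (sF n) (@FT n) _ mZ sZ (grad_noise_L2 n i)).
by move=> A; exact: G_unbiased.
Qed.

Lemma mean_second_moment_le n Z : adb n Z -> (forall w, 0 <= Z w) ->
  mean P (fun w => Z w * gam n w) <= K * mean P Z.
Proof.
move=> [mZ [c Zc]] Z0; apply: (@G_second_moment _ _ c) => // w.
by rewrite Z0 (le_trans _ (Zc w))// ler_norm.
Qed.

(** A weighted Jensen inequality: |grad g|^2 = <grad g, G> on average, and 2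
    <grad g, G> <= |grad g|^2 + |G|^2. *)
Lemma mean_gsq_le n Z : adb n Z -> (forall w, 0 <= Z w) ->
  mean P (fun w => Z w * b n w) <= K * mean P Z.
Proof.
move=> bZ Z0; apply: le_trans (mean_second_moment_le bZ Z0).
have bZu i := bounded_adaptedM bZ (grad_adb n i).
have iZ : L1 P (fun w => Z w * gam n w).
  exact: bounded_adapted_mul_L1 bZ (G_L1 n).
have iN i : L1 P (fun w => Z w * u n i w * (G n w 0 i - u n i w)).
  apply: bounded_adapted_mul_L1 (bZu i) _ => //.
  exact/L2_L1/grad_noise_L2.
(* Z (<grad g, G> - |grad g|^2) is centred. *)
have E0 : mean P (fun w => \sum_(i < d) Z w * u n i w * (G n w 0 i - u n i w)) = 0.
  rewrite mean_sum// big1// => i _; apply: grad_noise_centred; first by case: (bZu i).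
  exact: bounded_adapted_L2 (bZu i).
have iS : L1 P (fun w => \sum_(i < d) Z w * u n i w * (G n w 0 i - u n i w)).
  exact: L1_sum.
rewrite -[leRHS]subr0 -(mulr0 2) -E0 -meanZ// -meanB//; last exact: L1Z.
apply: le_mean.
- exact: bounded_adapted_L1 (bounded_adaptedM bZ (gsq_adb n)).
- by apply: L1B => //; exact: L1Z.
move=> w; have := dot_le (grad g (x n w)) (G n w).
have -> : \sum_(i < d) Z w * u n i w * (G n w 0 i - u n i w) =
          Z w * (dot (grad g (x n w)) (G n w) - b n w).
  rewrite /dot /gsq /nsq -sumrB mulr_sumr; apply: eq_bigr => i _; ring.
rewrite -/(gsq g (x^~ w) n).
set t := dot _ _ => tle.
have : Z w * (2 * t) <= Z w * (b n w + gam n w) by rewrite ler_wpM2l.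
by lra.
Qed.

Section Martingale.
Context (c : nat -> 'I_d -> T -> R).
Hypothesis c_adb : forall j i, adb j (c j i).

Definition noise j w := \sum_(i < d) c j i w * (G j w 0 i - u j i w).

Lemma noise_sum_L2 j : L2 P (noise j).
Proof.
apply: L2_sum => i.
exact: (bounded_adapted_mul_L2 F_filtration (c_adb j i) (grad_noise_L2 j i)).
Qed.

Lemma noise_sum_adapted j : measurable_wrt (F j.+1) (noise j).
Proof.
apply: measurable_sum => i; apply: measurable_funM.
  apply: (measurable_wrt_later F_filtration (leqnSn j)); by case: (c_adb j i).
apply: measurable_funB; first exact: G_adapted.
exact: (measurable_wrt_later F_filtration (leqnSn j) (@grad_adapted j i)).
Qed.

Lemma noise_sum_centred j (Z : T -> R) : measurable_wrt (F j) Z -> L2 P Z ->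
  mean P (fun w => Z w * noise j w) = 0.
Proof.
move=> mZ sZ.
have -> : (fun w => Z w * noise j w) = (fun w => \sum_(i < d)
    (c j i w * Z w) * (G j w 0 i - u j i w)).
  apply/funext => w; rewrite mulr_sumr; apply: eq_bigr => i _; ring.
have scZ i : L2 P (fun w => c j i w * Z w).
  exact: (bounded_adapted_mul_L2 F_filtration (c_adb j i) sZ).
rewrite mean_sum; last by move=> i; exact: L2_mul (grad_noise_L2 j i).
rewrite big1// => i _; apply: grad_noise_centred => //.
by apply: measurable_funM => //; case: (c_adb j i).
Qed.

(** By the Cauchy-Schwarz inequality the square of the increment is at most
    (sum of the c^2) |G - grad g|^2, and both |G|^2 and |grad g|^2 average to
    at most [K] under the predictable weight sum of the c^2. *)
Lemma noise_sum_variance j :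
  mean P (fun w => noise j w ^+ 2) <=
  4 * K * mean P (fun w => \sum_(i < d) c j i w ^+ 2).
Proof.
pose Z w := \sum_(i < d) c j i w ^+ 2.
have bZ : adb j Z.
  by apply: bounded_adapted_sum => i; exact: bounded_adaptedX.
have Z0 w : 0 <= Z w by apply: sumr_ge0 => i _; exact: sqr_ge0.
have iZg : L1 P (fun w => Z w * gam j w).
  exact: (bounded_adapted_mul_L1 F_filtration bZ (G_L1 j)).
have iZb : L1 P (fun w => Z w * b j w).
  exact: (bounded_adapted_L1 P F_filtration (bounded_adaptedM bZ (gsq_adb j))).
have le1 w : noise j w ^+ 2 <= 2 * (Z w * gam j w) + 2 * (Z w * b j w).
  have := dot_sqr_le (\row_i c j i w) (G j w - grad g (x j w)).
  have -> : dot (\row_i c j i w) (G j w - grad g (x j w)) = noise j w.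
    by apply: eq_bigr => i _; rewrite mxE [X in _ * X = _]mxE [in X in _ + X]mxE.
  have -> : nsq (\row_i c j i w) = Z w by apply: eq_bigr => i _; rewrite mxE.
  move=> /le_trans; apply.
  have := nsqD_le (G j w) (- grad g (x j w)); rewrite nsqN -/(gsq g (x^~ w) j).
  by move=> h; have := ler_wpM2l (Z0 w) h; lra.
apply: (le_trans (le_mean _ _ le1)).
- by case: (noise_sum_L2 j).
- by apply: L1D; exact: L1Z.
rewrite meanD; [|exact: L1Z|exact: L1Z].
rewrite !meanZ//.
by have := mean_second_moment_le bZ Z0; have := mean_gsq_le bZ Z0; rewrite -/Z; lra.
Qed.

Lemma runmax_noise_L1 n : L1 P (fun w => runmax (psum (noise^~ w)) n).
Proof. exact/L2_L1/runmax_L2/noise_sum_L2. Qed.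

Lemma mean_runmax_noise_le eta n : 0 < eta ->
  mean P (fun w => runmax (psum (noise^~ w)) n) <=
  eta + eta^-1 * (4 * K * \sum_(j < n) mean P (fun w => \sum_(i < d) c j i w ^+ 2)).
Proof.
move=> eta0; apply: (le_trans (mean_runmax_le F_filtration noise_sum_adapted
  noise_sum_L2 noise_sum_centred n eta0)).
rewrite lerD2l ler_wpM2l ?invr_ge0 ?(ltW eta0)// mulr_sumr.
by apply: ler_sum => j _; exact: noise_sum_variance.
Qed.

End Martingale.

Local Notation Psi n w := (potential g Lam q alpha0 K (x^~ w) (S^~ w) n).
Definition potential0 :=
  g x1 + K / 2 * rate0 + Lam * step_scale q alpha0 * s0 `^ (- (2 * q - 1)).
(** The summability of this sequence drives both conclusions. *)
Definition energy j := mean P (fun w => a j w * b j w).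
(** The weights for which [noise] is - a <grad g, G> + a |grad g|^2, the
    centred first-order term of the descent inequality. *)
Definition descent_coef j i w := - (a j w * u j i w).

Lemma potential_init w : Psi 0 w = potential0.
Proof. by rewrite /potential /rate /decay x_init S_init. Qed.

Lemma decay_adb n : adb n (fun w => decay q (S^~ w) n).
Proof.
split.
  have mS : measurable_fun [set: g_sigma_algebraType (F n)]
    (S n : g_sigma_algebraType (F n) -> R) by exact: S_adapted.
  exact: measurableT_comp (measurable_powR (- (2 * q - 1))) mS.
exists (s0 `^ (- (2 * q - 1))) => w; rewrite ger0_norm ?decay_ge0//.
have := decay_le0 q_gt (S0_gt0 w) (S_rec w) n.
by rewrite [X in _ <= X]/decay S_init.
Qed.

Lemma potential_adb n : adb n (fun w => Psi n w).
Proof.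
apply: bounded_adaptedD; last by apply: bounded_adaptedZ; exact: decay_adb.
apply: bounded_adaptedD; first exact: g_adb.
by apply: bounded_adaptedZ; exact: rate_adb.
Qed.

Lemma energy_adb j : adb j (fun w => a j w * b j w).
Proof. by apply: bounded_adaptedM; [exact: rate_adb|exact: gsq_adb]. Qed.

Lemma energy_term_ge0 j w : 0 <= a j w * b j w.
Proof. by rewrite mulr_ge0 ?gsq_ge0// ltW// rate_pos. Qed.

Lemma energy_ge0 j : 0 <= energy j.
Proof. by apply: mean_ge0 => w; exact: energy_term_ge0. Qed.

Lemma energy_noise_L1 j : L1 P (fun w => a j w * b j w * gam j w).
Proof. exact: (bounded_adapted_mul_L1 F_filtration (energy_adb j) (G_L1 j)). Qed.

Lemma descent_coef_adb j i : adb j (descent_coef j i).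
Proof.
have -> : descent_coef j i = (fun w => -1 * (a j w * u j i w)).
  by apply/funext => w; rewrite mulN1r.
apply: bounded_adaptedZ; apply: bounded_adaptedM; first exact: rate_adb.
exact: grad_adb.
Qed.

Lemma noise_descentE j w :
  noise descent_coef j w = - (a j w * dot (grad g (x j w)) (G j w)) + a j w * b j w.
Proof.
rewrite /noise /descent_coef /dot /gsq /nsq !mulr_sumr -sumrN -big_split /=.
by apply: eq_bigr => i _; ring.
Qed.

Lemma potential_step_noise j w :
  Psi j.+1 w <= Psi j w + noise descent_coef j w - a j w * b j w
                + (2 * K)^-1 * (a j w * b j w * gam j w).
Proof.
have := potential_step Lam_ge1 K_ge1 q_gt alpha0_gt0 g_diff g_lip (S0_gt0 w)
  (S_rec w) (x_rec w) j.
by rewrite noise_descentE addrA addrK [_^-1 * _]mulrC.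
Qed.

(** The first-order term contributes - energy, the correction at most half of
    energy. *)
Lemma mean_potential_energy n :
  mean P (fun w => Psi n w) + 2^-1 * (\sum_(j < n) energy j) <= potential0.
Proof.
elim: n => [|n IH].
  rewrite big_ord0 mulr0 addr0.
  by rewrite (eq_mean P potential_init) mean_cst.
have iP j : L1 P (fun w => Psi j w).
  exact: (bounded_adapted_L1 P F_filtration (potential_adb j)).
have iN : L1 P (noise descent_coef n).
  exact/L2_L1/noise_sum_L2/descent_coef_adb.
have iE : L1 P (fun w => a n w * b n w).
  exact: (bounded_adapted_L1 P F_filtration (energy_adb n)).
have iG := L1Z (2 * K)^-1 (energy_noise_L1 n).
have N0 : mean P (noise descent_coef n) = 0.
  have := noise_sum_centred descent_coef_adb (j := n) (Z := fun=> 1).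
  rewrite (_ : (fun w => 1 * _) = noise descent_coef n); last first.
    by apply/funext => w; rewrite mul1r.
  apply; first exact: measurable_cst.
  by apply: (@L2_bounded _ _ _ _ _ 1) => // w; rewrite normr1.
have := le_mean (iP n.+1) _ (potential_step_noise n).
rewrite meanD//; last by apply: L1B => //; exact: L1D.
rewrite meanB//; last exact: L1D.
rewrite meanD// N0 meanZ; last exact: energy_noise_L1.
have := mean_second_moment_le (energy_adb n) (energy_term_ge0 n).
rewrite -/(energy n) big_ord_recr /= => le1 le2.
have le3 : (2 * K)^-1 * mean P (fun w => a n w * b n w * gam n w) <= 2^-1 * energy n.
  rewrite invfM -mulrA ler_wpM2l// mulrC ler_pdivrMr// mulrC.
  exact: le1.
have {}le2 : mean P (fun w => Psi n.+1 w) <= mean P (fun w => Psi n w) + 0 - energy n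
    + (2 * K)^-1 * mean P (fun w => a n w * b n w * gam n w).
  by apply: le2; apply: L1D => //; apply: L1B => //; exact: L1D.
move: IH le2 le3; move: (mean P (fun w => Psi n w)) (mean P (fun w => Psi n.+1 w)).
move: (mean P (fun w => a n w * b n w * gam n w)) (\sum_(j < n) energy j).
by move: (energy n) potential0 => e0 p0 t s y z; lra.
Qed.

Lemma g_le_potential n w : g (x n w) <= Psi n w.
Proof.
rewrite /potential -addrA lerDl addr_ge0//.
  by rewrite mulr_ge0 ?(ltW (rate_pos _ _))// divr_ge0// ltW.
apply: mulr_ge0; last exact: decay_ge0.
by apply: mulr_ge0; [exact: ltW|exact: step_scale_ge0].
Qed.

Lemma energy_sum_le n : \sum_(j < n) energy j <= 2 * potential0.
Proof.
have := mean_potential_energy n.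
suff : 0 <= mean P (fun w => Psi n w) by lra.
by apply: mean_ge0 => w; apply: le_trans (g_le_potential n w).
Qed.

Definition gmax_bound := potential0 + 1 + (8 * K * rate0 + 1) * potential0.

Lemma runmax_g_L1 n : L1 P (fun w => runmax (fun k => g (x k w)) n).
Proof.
apply: L2_L1; elim: n => [|n IH] /=.
  exact: (bounded_adapted_L2 P F_filtration (g_adb 0)).
by apply: L2_max IH _; exact: (bounded_adapted_L2 P F_filtration (g_adb n.+1)).
Qed.

(** Summing the potential along the path: a martingale, plus a nondecreasing
    term of bounded mean; the remaining term - a |grad g|^2 is dropped. *)
Lemma runmax_g_le n w :
  runmax (fun k => g (x k w)) n <= potential0
    + runmax (psum (noise descent_coef ^~ w)) n
    + (2 * K)^-1 * (\sum_(j < n) a j w * b j w * gam j w).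
Proof.
have i2K : 0 <= (2 * K)^-1 by rewrite invr_ge0 mulr_ge0// ltW.
have t0 j : 0 <= a j w * b j w * gam j w.
  by rewrite mulr_ge0 ?nsq_ge0//; exact: energy_term_ge0.
have path k : Psi k w <= potential0 + psum (noise descent_coef ^~ w) k
    + (2 * K)^-1 * (\sum_(j < k) a j w * b j w * gam j w).
  elim: k => [|k IH].
    by rewrite potential_init /psum !big_ord0 mulr0 !addr0.
  rewrite psumS big_ord_recr /= mulrDr.
  by have := potential_step_noise k w; have := energy_term_ge0 k w; lra.
apply: runmax_le => k kn; apply: (le_trans (g_le_potential k w)).
apply: (le_trans (path k)); rewrite lerD//.
  by rewrite lerD2l; exact: runmax_ge.
rewrite ler_wpM2l// -(big_mkord xpredT (fun j => a j w * b j w * gam j w)).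
rewrite -(big_mkord xpredT (fun j => a j w * b j w * gam j w)).
by rewrite (big_cat_nat _ kn)//= lerDl sumr_ge0.
Qed.

Lemma mean_runmax_g_le n :
  mean P (fun w => runmax (fun k => g (x k w)) n) <= gmax_bound.
Proof.
have iN := runmax_noise_L1 descent_coef_adb n.
have iS : L1 P (fun w => \sum_(j < n) a j w * b j w * gam j w).
  exact: (L1_sum _ (fun j : 'I_n => energy_noise_L1 j)).
have iC := L1_cst P potential0.
apply: (le_trans (le_mean (runmax_g_L1 n) _ (runmax_g_le n))).
  by apply: L1D; [exact: L1D|exact: L1Z].
rewrite meanD; [|exact: L1D|exact: L1Z].
rewrite meanD// meanZ// mean_cst (mean_sum _ (fun j : 'I_n => energy_noise_L1 j)).
have := mean_runmax_noise_le descent_coef_adb n ltr01; rewrite invr1 mul1r.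
have coef_le j : mean P (fun w => \sum_(i < d) descent_coef j i w ^+ 2) <=
    rate0 * energy j.
  rewrite -meanZ; last exact: (bounded_adapted_L1 P F_filtration (energy_adb j)).
  apply: le_mean.
  - apply: (bounded_adapted_L1 P F_filtration (n := j)).
    apply: bounded_adapted_sum => i; apply: bounded_adaptedX.
    exact: descent_coef_adb.
  - apply: L1Z; exact: (bounded_adapted_L1 P F_filtration (energy_adb j)).
  move=> w.
  have -> : \sum_(i < d) descent_coef j i w ^+ 2 = a j w * (a j w * b j w).
    rewrite /descent_coef [in RHS]/gsq /nsq !mulr_sumr.
    by apply: eq_bigr => i _; ring.
  by rewrite ler_wpM2r ?energy_term_ge0 ?rate_le_rate0.
have coef_sum : \sum_(j < n) mean P (fun w => \sum_(i < d) descent_coef j i w ^+ 2)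
    <= rate0 * (2 * potential0).
  apply: (@le_trans _ _ (rate0 * \sum_(j < n) energy j)).
    by rewrite mulr_sumr; apply: ler_sum => j _; exact: coef_le.
  rewrite ler_wpM2l ?energy_sum_le// mulr_ge0 ?(ltW alpha0_gt0)// powR_ge0//.
have noise_sum : \sum_(j < n) mean P (fun w => a j w * b j w * gam j w) <=
    K * (2 * potential0).
  apply: (@le_trans _ _ (K * \sum_(j < n) energy j)).
    rewrite mulr_sumr; apply: ler_sum => j _.
    by apply: mean_second_moment_le; [exact: energy_adb|exact: energy_term_ge0].
  by rewrite ler_wpM2l ?energy_sum_le// ltW.
have := ler_wpM2l (ltW K0) coef_sum.
have i2K : 0 <= (2 * K)^-1 by rewrite invr_ge0 mulr_ge0// ltW.
have := ler_wpM2l i2K noise_sum.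
have -> : (2 * K)^-1 * (K * (2 * potential0)) = potential0.
  by field; rewrite gt_eqF.
by rewrite /gmax_bound; lra.
Qed.

(** The running maxima increase to the supremum and their means have a common
    bound. *)
Lemma integral_sup_g_le :
  (\int[P]_w ereal_sup (range (fun n => (g (x n w))%:E)) <= gmax_bound%:E)%E.
Proof.
pose m n w := (runmax (fun k => g (x k w)) n)%:E.
have m_nd w : {homo m ^~ w : k n / (k <= n)%N >-> (k <= n)%E}.
  apply/nondecreasing_seqP => n; rewrite lee_fin /=.
  by rewrite le_max lexx.
have m_meas n : measurable_fun [set: T] (m n).
  by apply/measurable_EFinP; exact: L1_measurable (runmax_g_L1 n).
have m0 n w : (0 <= m n w)%E.
  rewrite lee_fin (le_trans (g_ge0 (x n w)))//.
  exact: (runmax_ge (fun k => g (x k w))).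
have supE w : ereal_sup (range (fun n => (g (x n w))%:E)) = limn (m ^~ w).
  rewrite (cvg_lim _ (ereal_nondecreasing_cvgn (m_nd w)))//.
  apply/eqP; rewrite eq_le; apply/andP; split.
    apply: ge_ereal_sup => _ [n _ <-]; apply: ereal_sup_ge.
    exists (m n w); first by exists n.
    by rewrite lee_fin; exact: (runmax_ge (fun k => g (x k w))).
  apply: ge_ereal_sup => _ [n _ <-].
  elim: n => [|n IH]; first by apply: ereal_sup_ubound; exists 0%N.
  rewrite /m /= EFin_max ge_max IH /=.
  by apply: ereal_sup_ubound; exists n.+1.
under eq_integral do rewrite supE.
rewrite monotone_convergence//; apply: lime_le.
  apply: ereal_nondecreasing_is_cvgn => k n kn.
  by apply: ge0_le_integral => // w _; exact: m_nd.
apply: nearW => n; rewrite (mean_EFin (runmax_g_L1 n)) lee_fin.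
exact: mean_runmax_g_le.
Qed.

Definition mean_rate j := mean P (fun w => a j w).
(** The summable quantity that bounds all the losses after a given time: the
    energy and the decrease of the mean step size. *)
Definition dissipation j := energy j + (mean_rate j - mean_rate j.+1).

Lemma rate_L1 j : L1 P (fun w => a j w).
Proof. exact: (bounded_adapted_L1 P F_filtration (rate_adb j)). Qed.

Lemma energy_L1 j : L1 P (fun w => a j w * b j w).
Proof. exact: (bounded_adapted_L1 P F_filtration (energy_adb j)). Qed.

Lemma mean_rate_le j : mean_rate j.+1 <= mean_rate j.
Proof.
apply: le_mean; [exact: rate_L1|exact: rate_L1|move=> w].
exact: (rate_le q_gt alpha0_gt0 (S0_gt0 w) (S_rec w)).
Qed.

Lemma dissipation_ge0 j : 0 <= dissipation j.
Proof. by rewrite addr_ge0 ?energy_ge0 ?subr_ge0 ?mean_rate_le. Qed.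

Lemma energy_le_dissipation j : energy j <= dissipation j.
Proof. by rewrite lerDl subr_ge0 mean_rate_le. Qed.

Lemma dissipation_sum_le n :
  \sum_(j < n) dissipation j <= 2 * potential0 + rate0.
Proof.
rewrite big_split /= lerD ?energy_sum_le//.
rewrite sum_decrements.
have : mean_rate 0 <= rate0.
  rewrite -(mean_cst P rate0); apply: le_mean; [exact: rate_L1|exact: L1_cst|].
  by move=> w; exact: rate_le_rate0.
have : 0 <= mean_rate n by apply: mean_ge0 => w; exact: ltW (rate_pos n w).
by move: (mean_rate 0) (mean_rate n) rate0 => *; lra.
Qed.

Definition tail n M := \sum_(j < M) (n <= j)%:R * dissipation j.

Lemma tailE n M : (n <= M)%N ->
  tail n M = \sum_(j < M) dissipation j - \sum_(j < n) dissipation j.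
Proof.
rewrite /tail; elim: M => [|M IH].
  by rewrite leqn0 => /eqP ->; rewrite !big_ord0 subr0.
rewrite leq_eqVlt => /predU1P[->|nM].
  by rewrite subrr big1// => j _; rewrite leqNgt ltn_ord mul0r.
by rewrite !big_ord_recr /= IH// -ltnS nM mul1r addrAC.
Qed.

Lemma tail_small tau : 0 < tau ->
  exists N, forall n M, (N <= n)%N -> (n <= M)%N -> tail n M <= tau.
Proof.
move=> tau0; pose s n := \sum_(j < n) dissipation j.
have s_nd : nondecreasing_seq s.
  apply/nondecreasing_seqP => n; rewrite /s big_ord_recr /= lerDl.
  exact: dissipation_ge0.
have s_cvg : cvgn s.
  apply: nondecreasing_is_cvgn => //; exists (2 * potential0 + rate0).
  by move=> _ [n _ <-]; exact: dissipation_sum_le.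
have s_le n : s n <= limn s by exact: nondecreasing_cvgn_le.
have /cvgrPdist_le/(_ _ tau0)[N _ sN] := s_cvg.
exists N => n M Nn nM; rewrite tailE// -/(s M) -/(s n).
have := sN n Nn; have := s_le M; have := s_le n.
by rewrite ger0_norm ?subr_ge0//; lra.
Qed.

Local Notation abv e n w := (above g (x^~ w) e n).

Lemma above_adb e n : adb n (fun w => abv e n w).
Proof.
split; last by exists 1 => w; rewrite ger0_norm ?ler0n// lern1 leq_b1.
have mb : measurable_fun [set: g_sigma_algebraType (F n)]
  ((fun w => b n w) : g_sigma_algebraType (F n) -> R) by case: (gsq_adb n).
have mI : measurable_fun [set: R] (\1_(`[e, +oo[%classic : set R) : R -> R).
  by apply: measurable_indic; exact: measurable_itv.
have := measurableT_comp mI mb.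
congr (measurable_fun _ _); apply/funext => w /=.
rewrite /above indicE mem_setE in_itv /= andbT//.
Qed.

(** The weights, up to the sign [sg], for which [noise] is [fluct]. Both
    signs are needed, since the maximal inequality is one-sided. *)
Definition excursion_coef (sg e : R) n (i : 'I_d) j (k : 'I_d) w :=
  (k == i)%:R * (sg * ((n <= j)%:R * abv e j w * a j w)).

Lemma excursion_coef_adb sg e n i j k : adb j (excursion_coef sg e n i j k).
Proof.
apply: bounded_adaptedZ; apply: bounded_adaptedZ; apply: bounded_adaptedM.
  by apply: bounded_adaptedZ; exact: above_adb.
exact: rate_adb.
Qed.

Lemma noise_excursionE sg e n i j w : noise (excursion_coef sg e n i) j w =
  sg * fluct g q alpha0 (x^~ w) (G^~ w) (S^~ w) e n i j.
Proof.
rewrite /noise (bigD1 i)//= big1 ?addr0 => [|k /negPf ki]; last first.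
  by rewrite /excursion_coef ki !mul0r.
by rewrite /excursion_coef eqxx mul1r /fluct -mulrA.
Qed.

(** The square of the indicator is the indicator, at most gsq / e, and a^2 <=
    rate0 a. *)
Lemma mean_excursion_coef_le sg e n i j : 0 < e -> sg ^+ 2 = 1 ->
  mean P (fun w => \sum_(k < d) excursion_coef sg e n i j k w ^+ 2) <=
  rate0 / e * ((n <= j)%:R * dissipation j).
Proof.
move=> e0 sg1.
apply: (@le_trans _ _ (rate0 / e * ((n <= j)%:R * energy j))); last first.
  rewrite ler_wpM2l//; last by rewrite ler_wpM2l// energy_le_dissipation.
  by rewrite divr_ge0 ?(ltW e0)// mulr_ge0 ?powR_ge0// ltW.
rewrite mulrA -meanZ; last exact: energy_L1.
apply: le_mean.
- apply: (bounded_adapted_L1 P F_filtration (n := j)).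
  by apply: bounded_adapted_sum => k; apply: bounded_adaptedX; exact: excursion_coef_adb.
- by apply: L1Z; exact: energy_L1.
move=> w; rewrite (bigD1 i)//= big1 ?addr0 => [|k /negPf ki]; last first.
  by rewrite /excursion_coef ki mul0r expr0n.
rewrite /excursion_coef eqxx mul1r exprMn sg1 mul1r -mulrA exprMn.
have b01 (B : bool) : (B%:R : R) ^+ 2 = B%:R by case: B; rewrite ?expr1n ?expr0n.
rewrite b01 exprMn [abv e j w ^+ 2]b01 -/(abv e j w).
rewrite [leRHS](_ : _ = (n <= j)%:R * (rate0 / e * (a j w * b j w))); last by ring.
rewrite ler_wpM2l//.
have -> : rate0 / e * (a j w * b j w) = (b j w / e) * (rate0 * a j w) by ring.
rewrite ler_pM ?ler0n ?sqr_ge0//; first exact: above_le.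
by rewrite expr2 ler_wpM2r ?rate_le_rate0// ltW// rate_pos.
Qed.

Lemma fluct_L1 sg e n i M : L1 P (fun w => runmax (psum (fun j =>
  sg * fluct g q alpha0 (x^~ w) (G^~ w) (S^~ w) e n i j)) M).
Proof.
have := runmax_noise_L1 (excursion_coef_adb sg e n i) M.
congr (L1 P _); apply/funext => w; congr (runmax (psum _) M).
by apply/funext => j; exact: noise_excursionE.
Qed.

Lemma mean_fluct_le sg e n i M eta : 0 < e -> sg ^+ 2 = 1 -> 0 < eta ->
  mean P (fun w => runmax (psum (fun j =>
    sg * fluct g q alpha0 (x^~ w) (G^~ w) (S^~ w) e n i j)) M) <=
  eta + eta^-1 * (4 * K * (rate0 / e * tail n M)).
Proof.
move=> e0 sg1 eta0.
have := mean_runmax_noise_le (excursion_coef_adb sg e n i) M eta0.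
rewrite (_ : mean P _ = mean P (fun w => runmax (psum (fun j =>
    sg * fluct g q alpha0 (x^~ w) (G^~ w) (S^~ w) e n i j)) M)); last first.
  apply: eq_mean => w; congr (runmax (psum _) M).
  by apply/funext => j; exact: noise_excursionE.
move=> /le_trans; apply; rewrite lerD2l.
rewrite ler_wpM2l ?invr_ge0 ?(ltW eta0)// ler_wpM2l ?mulr_ge0 ?(ltW K0)//.
by rewrite /tail mulr_sumr; apply: ler_sum => j _; exact: mean_excursion_coef_le.
Qed.

Local Notation dri e j w := (drift g q alpha0 (x^~ w) (G^~ w) (S^~ w) e j).
Local Notation exc e n M i w :=
  (excursion g q alpha0 (x^~ w) (G^~ w) (S^~ w) e n M i).

Lemma drift_L1 e j : L1 P (fun w => dri e j w).
Proof.
apply: L1D; first apply: L1D.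
- by apply: L1Z; exact: energy_L1.
- by apply: L1Z; exact: energy_noise_L1.
- by apply: L1B; exact: rate_L1.
Qed.

Lemma mean_drift_le e j : 0 < e ->
  mean P (fun w => dri e j w) <= (1 + (1 + K) / e) * dissipation j.
Proof.
move=> e0; have ei : 0 < e^-1 by rewrite invr_gt0.
have i1 := L1Z (e^-1 + 1) (energy_L1 j).
have i2 := L1Z e^-1 (energy_noise_L1 j).
rewrite meanD; [|exact: L1D|by apply: L1B; exact: rate_L1].
rewrite meanD// meanB; [|exact: rate_L1|exact: rate_L1].
rewrite (meanZ _ (energy_L1 j)) (meanZ _ (energy_noise_L1 j)).
have := mean_second_moment_le (energy_adb j) (energy_term_ge0 j).
rewrite -/(energy j) -/(mean_rate j) -/(mean_rate j.+1) => le1.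
have := ler_wpM2l (ltW ei) le1.
have D0 : 0 <= mean_rate j - mean_rate j.+1 by rewrite subr_ge0 mean_rate_le.
rewrite /dissipation.
have : 0 <= (1 + K) / e * (mean_rate j - mean_rate j.+1).
  by rewrite mulr_ge0// divr_ge0 ?(ltW e0)// addr_ge0// ltW.
move: le1 D0; move: (mean P _) (energy j) (mean_rate j) (mean_rate j.+1) (e^-1).
by move=> A B m m' r; lra.
Qed.

Lemma excursion_L1 e n M i : L1 P (fun w => exc e n M i w).
Proof.
apply: L1D; first apply: L1D.
- have := fluct_L1 1 e n i M; congr (L1 P _); apply/funext => w.
  by congr (runmax (psum _) M); apply/funext => j; rewrite mul1r.
- have := fluct_L1 (-1) e n i M; congr (L1 P _); apply/funext => w.
  by congr (runmax (psum _) M); apply/funext => j; rewrite mulN1r.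
- by apply: (L1_sum _ (fun j : 'I_M => L1Z _ (drift_L1 e j))).
Qed.

(** The free parameter eta of the maximal inequality remains: the mean of the
    maximum is at most 2 eta plus this multiple of the tail of a convergent
    series, so it tends to zero as the starting time grows. *)
Definition excursion_gain (eta e : R) :=
  8 * K * rate0 / (eta * e) + (1 + (1 + K) / e).

Lemma mean_excursion_le e n M i eta : 0 < e -> 0 < eta ->
  mean P (fun w => exc e n M i w) <= 2 * eta + excursion_gain eta e * tail n M.
Proof.
move=> e0 eta0.
have E1 : (fun w => exc e n M i w) = (fun w =>
  runmax (psum (fun j =>
    1 * fluct g q alpha0 (x^~ w) (G^~ w) (S^~ w) e n i j)) M +
  runmax (psum (fun j =>
    -1 * fluct g q alpha0 (x^~ w) (G^~ w) (S^~ w) e n i j)) M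
  + \sum_(j < M) (n <= j)%:R * dri e j w).
  apply/funext => w; rewrite /excursion; congr (_ + _ + _).
    by congr (runmax (psum _) M); apply/funext => j; rewrite mul1r.
  by congr (runmax (psum _) M); apply/funext => j; rewrite mulN1r.
have iD : L1 P (fun w => \sum_(j < M) (n <= j)%:R * dri e j w).
  by apply: (L1_sum _ (fun j : 'I_M => L1Z _ (drift_L1 e j))).
rewrite E1 meanD//; last by apply: L1D; exact: fluct_L1.
rewrite meanD; [|exact: fluct_L1|exact: fluct_L1].
rewrite (mean_sum _ (fun j : 'I_M => L1Z _ (drift_L1 e j))).
have sg1 : (-1) ^+ 2 = 1 :> R by rewrite sqrrN expr1n.
have := mean_fluct_le n i M e0 (expr1n _ 2) eta0.
have := mean_fluct_le n i M e0 sg1 eta0.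
have : \sum_(j < M) mean P (fun w => (n <= j)%:R * dri e j w) <=
    (1 + (1 + K) / e) * tail n M.
  rewrite /tail mulr_sumr; apply: ler_sum => j _.
  rewrite meanZ; last exact: drift_L1.
  by rewrite mulrCA ler_wpM2l// mean_drift_le.
have -> : excursion_gain eta e * tail n M =
  2 * (eta^-1 * (4 * K * (rate0 / e * tail n M))) + (1 + (1 + K) / e) * tail n M.
  by rewrite /excursion_gain; field; rewrite !gt_eqF.
by lra.
Qed.

Lemma mean_S_le n : L1 P (S n) /\ mean P (S n) <= (s0 + K) * n.+1%:R.
Proof.
have gamK j : mean P (fun w => gam j w) <= K.
  have := mean_second_moment_le (bounded_adapted_cst F j 1) (fun=> ler01).
  rewrite mean_cst mulr1 => /(le_trans _); apply.
  by rewrite le_eqVlt; apply/orP; left; apply/eqP/eq_mean => w; rewrite mul1r.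
elim: n => [|n [iS ES]].
  have -> : S 0 = (fun=> s0) by apply/funext => w; exact: S_init.
  by split; [exact: L1_cst|rewrite mean_cst mulr1 lerDl ltW].
have -> : S n.+1 = (fun w => S n w + gam n w) by apply/funext => w; exact: S_rec.
split; first exact: L1D.
rewrite meanD// [n.+2%:R]mulrS mulrDr mulr1 addrC lerD//.
by apply: (le_trans (gamK n)); rewrite lerDr ltW.
Qed.

(** The probability that the squared gradient stays above [e] from time [n]
    to time [M]. *)
Definition mean_stay e n M := mean P (fun w => \prod_(n <= j < M) abv e j w).

Lemma stay_prod01 e n M w : 0 <= \prod_(n <= j < M) abv e j w <= 1.
Proof.
elim: M => [|M IH]; first by rewrite big_geq// ler01 lexx.
have [Mn|nM] := ltnP M n; first by rewrite big_geq// ler01 lexx.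
rewrite big_nat_recr//=; case/andP: IH => p0 p1.
by rewrite mulr_ge0 ?ler0n//= mulr_ile1 ?ler0n// lern1 leq_b1.
Qed.

Lemma stay_L1 e n M : L1 P (fun w => \prod_(n <= j < M) abv e j w).
Proof.
apply: (@L1_bounded _ _ _ _ _ 1); last first.
  by move=> w; case/andP: (stay_prod01 e n M w) => p0 p1; rewrite ger0_norm.
elim: M => [|M IH].
  have -> : (fun w => \prod_(n <= j < 0) abv e j w) = (fun=> 1).
    by apply/funext => w; rewrite big_geq.
  exact: measurable_cst.
have [Mn|nM] := ltnP M n.
  have -> : (fun w => \prod_(n <= j < M.+1) abv e j w) = (fun=> 1).
    by apply/funext => w; rewrite big_geq.
  exact: measurable_cst.
have -> : (fun w => \prod_(n <= j < M.+1) abv e j w) =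
          (fun w => \prod_(n <= j < M) abv e j w * abv e M w).
  by apply/funext => w; rewrite big_nat_recr.
apply: measurable_funM => //.
exact: (bounded_adapted_measurable F_filtration (above_adb e M)).
Qed.

(** On the event of staying above [e], the energy at time [j] is at least e
    times the step size, which is bounded below through 1 / S >= 2 t - t^2 S.
    *)
Lemma mean_stay_energy e n j t : q <= 1 -> 0 < e -> (n <= j)%N ->
  e * (alpha0 * s0 `^ (1 - q)) *
    (2 * t * mean_stay e n j.+1 - t ^+ 2 * ((s0 + K) * j.+1%:R)) <= energy j.
Proof.
move=> q1 e0 nj; have [iS ES] := mean_S_le j.
set c := alpha0 * s0 `^ (1 - q).
have c0 : 0 <= c by rewrite mulr_ge0 ?powR_ge0// ltW.
have ec0 : 0 <= e * c by rewrite mulr_ge0// ltW.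
have iJ := L1Z (2 * t) (stay_L1 e n j.+1).
have iS2 := L1Z (t ^+ 2) iS.
apply: (@le_trans _ _ (e * c * (2 * t * mean_stay e n j.+1 - t ^+ 2 * mean P (S j)))).
  by rewrite ler_wpM2l// lerD2l lerN2 ler_wpM2l// sqr_ge0.
rewrite -(meanZ _ (stay_L1 e n j.+1)) -(meanZ _ iS) -meanB// -meanZ; last exact: L1B.
apply: le_mean; [by apply: L1Z; exact: L1B|exact: energy_L1|move=> w].
have Sw : 0 < S j w by exact: (S_gt0 (S0_gt0 w) (S_rec w)).
have := rate_ge alpha0_gt0 (S0_gt0 w) (S_rec w) j t q1; rewrite S_init -/c => rge.
rewrite big_nat_recr//=.
have := stay_prod01 e n j w; set p := \prod_(_ <= _ < _) _ => /andP[p0 p1].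
have a0 := rate_pos j w.
have [eb|be] := boolP (e <= b j w)%R; last first.
  have -> : abv e j w = 0 by rewrite /above (negPf be).
  rewrite mulr0 mulr0 sub0r mulrN; apply: le_trans (energy_term_ge0 j w).
  by rewrite oppr_le0 mulr_ge0// mulr_ge0 ?sqr_ge0// ltW.
have -> : abv e j w = 1 by rewrite /above eb.
rewrite mulr1; apply: (@le_trans _ _ (e * (p * a j w))); last first.
  apply: (@le_trans _ _ (e * a j w)).
    by rewrite ler_wpM2l ?(ltW e0)// ler_piMl// ltW.
  by rewrite mulrC ler_wpM2l// ltW.
rewrite -[leLHS]mulrA ler_wpM2l ?(ltW e0)//.
apply: (@le_trans _ _ (p * (c * (2 * t - t ^+ 2 * S j w)))); last first.
  by rewrite ler_wpM2l.
have -> : p * (c * (2 * t - t ^+ 2 * S j w)) = c * (2 * t * p - p * (t ^+ 2 * S j w)).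
  by ring.
rewrite ler_wpM2l// lerD2l lerN2 ler_piMl// mulr_ge0 ?sqr_ge0//.
exact: ltW.
Qed.

(** Otherwise the energy at time [j] would be at least a multiple of 1 / (j +
    1), and the harmonic series would converge. *)
Lemma mean_stay_small e n eta : q <= 1 -> 0 < e -> 0 < eta ->
  exists2 M, (n <= M)%N & mean_stay e n M <= eta.
Proof.
move=> q1 e0 eta0; apply: contrapT => big_stays.
have stays_gt j : (n <= j)%N -> eta < mean_stay e n j.+1.
  move=> nj; rewrite ltNge; apply/negP => small.
  by apply: big_stays; exists j.+1 => //; exact: leqW.
have sK0 : 0 < s0 + K by exact: addr_gt0.
pose c := e * (alpha0 * s0 `^ (1 - q)) * eta ^+ 2 / (s0 + K).
have c0 : 0 < c.
  by rewrite divr_gt0// !mulr_gt0// ?powR_gt0// exprn_gt0.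
have harm j : (n <= j)%N -> c * harmonic j <= energy j.
  (* This t maximises 2 t eta - t^2 (s0 + K) (j + 1). *)
  move=> nj; set t := eta / ((s0 + K) * j.+1%:R).
  have j0 : 0 < j.+1%:R :> R by rewrite ltr0n.
  apply: le_trans (mean_stay_energy t q1 e0 nj).
  have t0 : 0 < t by rewrite divr_gt0// mulr_gt0.
  have -> : c * harmonic j = e * (alpha0 * s0 `^ (1 - q)) *
      (2 * t * eta - t ^+ 2 * ((s0 + K) * j.+1%:R)).
    rewrite /c (_ : harmonic j = j.+1%:R^-1)// /t.
    move: (s0 `^ (1 - q)) (s0 + K) (j.+1%:R : R) sK0 j0 => A s m s_gt m_gt.
    by field; rewrite !gt_eqF.
  apply: ler_wpM2l; first by rewrite !mulr_ge0 ?powR_ge0// ltW.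
  rewrite lerD2r; apply: ler_wpM2l; first by rewrite mulr_ge0// ltW.
  exact/ltW/stays_gt.
apply: (@dvg_harmonic R); apply: nondecreasing_is_cvgn.
  by apply: nondecreasing_series => j _ _; rewrite /harmonic invr_ge0.
exists (\sum_(j < n) harmonic j + 2 * potential0 / c) => _ [M _ <-].
rewrite /series /=.
have sumM m : \sum_(0 <= j < m) harmonic j <=
    \sum_(j < n) harmonic j + (\sum_(j < m) energy j) / c :> R.
  elim: m => [|m IH].
    rewrite big_geq// big_ord0 mul0r addr0 sumr_ge0// => j _.
    by rewrite /harmonic invr_ge0.
  have [mn|nm] := ltnP m n.
    rewrite big_mkord; apply: (@le_trans _ _ (\sum_(j < n) harmonic j)).
      rewrite -!(big_mkord xpredT (@harmonic R)) (big_cat_nat _ mn)//= lerDl.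
      by apply: sumr_ge0 => j _; rewrite /harmonic invr_ge0.
    rewrite lerDl divr_ge0 ?(ltW c0)// sumr_ge0// => j _; exact: energy_ge0.
  rewrite big_nat_recr//= big_ord_recr/= mulrDl addrA lerD//.
  by rewrite ler_pdivlMr// mulrC harm.
apply: (le_trans (sumM M)); rewrite lerD2l ler_wpM2r ?energy_sum_le//.
by rewrite invr_ge0 ltW.
Qed.

(** The mean of gsq is at most 4 e plus K times the probability that gsq is
    at least 4 e, by the bound on weighted squared gradients; that
    probability is controlled by an excursion, small for large [n], and by
    the probability of staying above e up to a horizon [M] chosen after [n].
    *)
Lemma mean_gsq_small delta : q <= 1 -> 0 < delta ->
  exists N, forall n, (N <= n)%N -> mean P (fun w => b n w) <= delta.
Proof.
move=> q1 delta0.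
pose kappa := Num.sqrt (delta / (16 * Lam)).
have kappa0 : 0 < kappa by rewrite sqrtr_gt0 divr_gt0// mulr_gt0.
pose e := Lam * kappa ^+ 2.
have eE : e = delta / 16.
  rewrite /e sqr_sqrtr; last by rewrite divr_ge0 ?(ltW delta0)// mulr_ge0// ltW.
  by field; rewrite gt_eqF.
have e0 : 0 < e by rewrite eE divr_gt0.
(* The coordinates are bounded one by one by 2 r, of which half is the
   parameter of the maximal inequality and half the tail; [d.+1] instead of
   [d] avoids a division by zero. *)
pose r := delta * kappa / (4 * K * d.+1%:R).
have r0 : 0 < r by rewrite divr_gt0// !mulr_gt0// ltr0n.
have r20 : 0 < r / 2 by rewrite divr_gt0.
pose C := excursion_gain (r / 2) e.
have C0 : 0 < C.
  have rate00 : 0 <= rate0 by rewrite mulr_ge0 ?powR_ge0// ltW.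
  have B0 : 0 <= 8 * K * rate0 / (r / 2 * e).
    apply: divr_ge0; apply: mulr_ge0 => //; [|exact: ltW|exact: ltW].
    by apply: mulr_ge0 => //; exact: ltW.
  have Ke0 : 0 < (1 + K) / e by rewrite divr_gt0// addr_gt0.
  by apply: ltr_wpDl => //; exact: addr_gt0.
have [N tailN] := tail_small (divr_gt0 r0 C0).
exists N => n Nn.
have dK0 : 0 < delta / (4 * K) by rewrite divr_gt0// mulr_gt0.
have [M nM staysM] := mean_stay_small n q1 e0 dK0.
have bH : adb n (fun w => abv (4 * e) n w) by exact: above_adb.
have iH := bounded_adapted_L1 P F_filtration bH.
have iE i := excursion_L1 e n M i.
have iES : L1 P (fun w => \sum_(i < d) exc e n M i w) by exact: L1_sum.
have prob : mean P (fun w => abv (4 * e) n w) <=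
    kappa^-1 * (d%:R * (2 * r)) + delta / (4 * K).
  apply: (@le_trans _ _ (kappa^-1 * (\sum_(i < d) mean P (fun w => exc e n M i w))
                         + mean_stay e n M)).
    rewrite -(mean_sum _ iE) -meanZ// -meanD//; [|exact: L1Z|exact: stay_L1].
    apply: le_mean => //; first by apply: L1D; [exact: L1Z|exact: stay_L1].
    move=> w; exact: (high_gradient_le Lam_ge1 q_gt alpha0_gt0 g_lip (S0_gt0 w)
      (S_rec w) (x_rec w) kappa0 nM).
  apply: lerD => //; rewrite ler_wpM2l ?invr_ge0 ?(ltW kappa0)//.
  rewrite mulr_natl -[d in _ *+ d]card_ord -sumr_const; apply: ler_sum => i _.
  apply: (le_trans (mean_excursion_le n M i e0 r20)).
  have := tailN n M Nn nM; rewrite ler_pdivlMr// -/C mulrC => CT.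
  by rewrite mulrCA mulfV// mulr1 [leRHS]mulr_natl mulr2n lerD.
have split_b : mean P (fun w => b n w) <= 4 * e + K * mean P (fun w => abv (4 * e) n w).
  have iHb : L1 P (fun w => abv (4 * e) n w * b n w).
    exact: (bounded_adapted_L1 P F_filtration (bounded_adaptedM bH (gsq_adb n))).
  apply: (@le_trans _ _ (4 * e + mean P (fun w => abv (4 * e) n w * b n w))).
    have <- : mean P (fun w => 4 * e + abv (4 * e) n w * b n w) =
        4 * e + mean P (fun w => abv (4 * e) n w * b n w).
      by rewrite meanD ?mean_cst//; exact: L1_cst.
    apply: le_mean.
    - exact: (bounded_adapted_L1 P F_filtration (gsq_adb n)).
    - by apply: L1D => //; exact: L1_cst.
    move=> w; rewrite /above; case: (leP (4 * e) (gsq g (x^~ w) n)) => bw.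
      by rewrite mul1r lerDr mulr_ge0// ltW.
    by rewrite mul0r addr0 ltW.
  by rewrite lerD2l; apply: mean_gsq_le => // w; rewrite ler0n.
apply: (le_trans split_b).
have := ler_wpM2l (ltW K0) prob; rewrite mulrDr.
have -> : K * (delta / (4 * K)) = delta / 4 by field; rewrite gt_eqF.
have -> : K * (kappa^-1 * (d%:R * (2 * r))) = delta / 2 * (d%:R / d.+1%:R).
  by rewrite /r; field; rewrite !gt_eqF// ltr0n.
have : delta / 2 * (d%:R / d.+1%:R) <= delta / 2.
  rewrite ler_piMr ?divr_ge0 ?(ltW delta0)// ler_pdivrMr ?ltr0n// mul1r ler_nat.
  exact: leqnSn.
rewrite eE; move: (K * _) (delta / 2 * _) => A B; lra.
Qed.

End Stochastic.

(** * Continuous functions of a random vector *)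

Section EuclideanMeasurability.
Context (R : realType) (d : nat).

(** Inverse images of open intervals are open, hence members of the
    generating family of the Borel sets. *)
Lemma continuous_measurable_rV (h : 'rV[R]_d -> R) : continuous h ->
  measurable_fun [set: borel_rV R d] (h : borel_rV R d -> R).
Proof.
move=> /continuousP hc; apply: (measurability _ (RGenOpens.measurableE R)).
move=> _ [_ [a [b ->] <-]]; rewrite setTI; apply: sub_sigma_algebra.
by apply: hc; exact: interval_open.
Qed.

Lemma measurable_wrt_continuous (disp : measure_display)
    (T : measurableType disp) (H : set (set T)) (Y : T -> 'rV[R]_d)
    (h : 'rV[R]_d -> R) :
  continuous h -> measurable_wrt H (Y : T -> borel_rV R d) ->
  measurable_wrt H (fun w => h (Y w)).
Proof.
move=> hc mY; have mY' : measurable_fun [set: g_sigma_algebraType H]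
  (Y : g_sigma_algebraType H -> borel_rV R d) by exact: mY.
exact: measurableT_comp (continuous_measurable_rV hc) mY'.
Qed.

End EuclideanMeasurability.

Theorem theorem4 (R : realType) (disp : measure_display)
  (T : measurableType disp) (P : probability T R) (F : nat -> set (set T))
  (d : nat) (g : 'rV[R]_d -> R) (L q alpha0 s0 beta sigma K : R)
  (theta1 : 'rV[R]_d) (S : nat -> T -> R) (theta G : nat -> T -> 'rV[R]_d)
  (M : nat -> T -> 'rV[R]_d) (V : nat -> T -> \bar R)
  (F_filtration : filtration F)
  (theta_meas : forall n, (1 <= n)%N ->
     measurable_wrt (F n.-1) (theta n : T -> borel_rV R d))
  (S_meas : forall n, (1 <= n)%N -> measurable_wrt (F n.-1) (S n.-1))
  (G_meas : forall n, (1 <= n)%N ->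
     measurable_wrt (F n) (G n : T -> borel_rV R d))
  (g_ge0 : forall x, 0 <= g x)
  (g_C1 : continuously_differentiable g)
  (g_lip : forall x y, enorm (grad g x - grad g y) <= L * enorm (x - y))
  (q_gt : 2^-1 < q)
  (alpha0_gt0 : 0 < alpha0)
  (s0_gt0 : 0 < s0)
  (S_init : forall w, S 0%N w = s0)
  (theta_init : forall w, theta 1%N w = theta1)
  (S_rec : forall n, (1 <= n)%N ->
     forall w, S n w = S n.-1 w + enorm (G n w) ^+ 2)
  (theta_rec : forall n, (1 <= n)%N ->
     forall w, theta n.+1 w = theta n w - (alpha0 * S n w `^ (- q)) *: G n w)
  (beta_ge0 : 0 <= beta)
  (sigma_ge0 : 0 <= sigma)
  (M_cond_exp : forall n, (1 <= n)%N -> cond_exp_rV P (F n.-1) (G n) (M n))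
  (V_cond_exp : forall n, (1 <= n)%N ->
     cond_exp P (F n.-1) (fun w => (enorm (G n w) ^+ 2)%:E) (V n))
  (G_unbiased : forall n, (1 <= n)%N ->
     {ae P, forall w, M n w = grad g (theta n w)})
  (G_variance : forall n, (1 <= n)%N ->
     {ae P, forall w,
       (V n w <= (beta * enorm (grad g (theta n w)) ^+ 2 + sigma ^+ 2)%:E)%E})
  (G_bounded : forall n, (1 <= n)%N ->
     {ae P, forall w, (V n w <= K%:E)%E}) :
  (\int[P]_w ereal_sup [set (g (theta n w))%:E | n in [set n | (1 <= n)%N]]
     < +oo)%E /\
  (q <= 1 ->
     'E_P[fun w => (enorm (grad g (theta n w)) ^+ 2)%R]%E @[n --> \oo] --> 0%E).
Proof.
(* Time is shifted by one, so that everything at time [n] is known for [F n]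
   and the gradient noise at time [n] for [F n.+1]. The constants are replaced
   by larger ones: [L] may be negative, and [K] has to be at least 1 as a
   divisor. *)
pose x n := theta n.+1; pose G' n := G n.+1.
pose Lam := 1 + L ^+ 2; pose K' := 1 + `|K|.
have [g_diff grad_cont] := g_C1.
have [sF FT _] := F_filtration.
have Lam_ge1 : 1 <= Lam by rewrite lerDl sqr_ge0.
have K'_ge1 : 1 <= K' by rewrite lerDl.
have K'_ge0 : 0 <= K' := le_trans ler01 K'_ge1.
have g_lip' z z' : nsq (grad g z - grad g z') <= Lam * nsq (z - z').
  rewrite -!enorm_sqr; have e0 (v : 'rV[R]_d) : 0 <= enorm v by exact: sqrtr_ge0.
  have := g_lip z z'; have := e0 (grad g z - grad g z').
  have := sqr_ge0 (enorm (z - z')); rewrite /Lam.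
  move: (enorm (z - z')) (enorm (grad g z - grad g z')) => y z0 y2 z00 zle.
  have : z0 ^+ 2 <= (L * y) ^+ 2 by apply: lerXn2r => //; rewrite nnegrE (le_trans z00).
  by rewrite exprMn; lra.
have coord_cont i : continuous (fun v : 'rV[R]_d => v 0 i).
  exact: coord_continuous.
have S_init' w : S 0 w = s0 by exact: S_init.
have x_init w : x 0 w = theta1 by exact: theta_init.
have S_rec' w n : S n.+1 w = S n w + nsq (G' n w).
  by rewrite S_rec// enorm_sqr.
have x_rec w n : x n.+1 w = x n w - (alpha0 * S n.+1 w `^ (- q)) *: G' n w.
  exact: theta_rec.
have S_ad n : measurable_wrt (F n) (S n) by exact: (S_meas n.+1).
have x_ad n : measurable_wrt (F n) (x n : T -> borel_rV R d).
  exact: (theta_meas n.+1).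
have g_ad n : measurable_wrt (F n) (fun w => g (x n w)).
  apply: measurable_wrt_continuous (x_ad n) => z.
  exact: differentiable_continuous.
have grad_ad n i : measurable_wrt (F n) (fun w => grad g (x n w) 0 i).
  apply: (@measurable_wrt_continuous _ _ _ _ _ _ (fun z => grad g z 0 i)) (x_ad n).
  move=> z; have := @continuous_comp _ _ _ (grad g) (fun v : 'rV[R]_d => v 0 i) z.
  by apply; [exact: grad_cont|exact: coord_cont].
have G_ad n i : measurable_wrt (F n.+1) (fun w => G' n w 0 i).
  apply: (@measurable_wrt_continuous _ _ _ _ _ _ (fun v => v 0 i)).
    exact: coord_cont.
  exact: (G_meas n.+1).
have V_ce n : cond_exp P (F n) (EFin \o (fun w => nsq (G' n w))) (V n.+1).
  have := V_cond_exp n.+1 isT.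
  by congr (cond_exp P _ _ _); apply/funext => w /=; rewrite enorm_sqr.
have V_le n : {ae P, forall w, (V n.+1 w <= K'%:E)%E}.
  apply: filterS (@G_bounded n.+1 isT) => w /le_trans; apply.
  by rewrite lee_fin (le_trans (ler_norm K))// lerDr.
have nsqG0 n w : 0 <= nsq (G' n w) by exact: nsq_ge0.
have G_L1 n : L1 P (fun w => nsq (G' n w)).
  exact: cond_exp_le_L1 (sF n) (@FT n) K'_ge0 (nsqG0 n) (V_ce n) (V_le n).
have S0_gt0 w : 0 < S 0 w by rewrite S_init'.
have grad_b n i : bounded_adapted F n (fun w => grad g (x n w) 0 i).
  exact: (grad_adb Lam_ge1 q_gt s0_gt0 g_lip' S_init' x_init S_rec' x_rec grad_ad).
have G_unb n i A : F n A ->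
    mean P (fun w => \1_A w * (G' n w 0 i - grad g (x n w) 0 i)) = 0.
  move=> FA; have [iG ceG] := M_cond_exp n.+1 isT i.
  apply: (cond_exp_mean_indic (sF n) (@FT n) iG _ ceG _ FA).
    exact: (bounded_adapted_L1 P F_filtration (grad_b n i)).
  by apply: filterS (G_unbiased n.+1 isT) => w /= ->.
have G_2nd n (Z : T -> R) c : measurable_wrt (F n) Z ->
    (forall w, 0 <= Z w <= c) ->
    mean P (fun w => Z w * nsq (G' n w)) <= K' * mean P Z.
  exact: cond_exp_le_mean_mul (sF n) (@FT n) K'_ge0 (nsqG0 n) (V_ce n) (V_le n).
split.
  apply: le_lt_trans (ltry (gmax_bound g Lam q alpha0 K' s0 theta1)).
  rewrite [leLHS](_ : _ = (\int[P]_w ereal_sup (range (fun n => (g (x n w))%:E)))%E).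
    exact: (integral_sup_g_le F_filtration Lam_ge1 K'_ge1 q_gt
    alpha0_gt0 s0_gt0 g_ge0 g_diff g_lip' S_init' x_init S_rec' x_rec S_ad g_ad
    grad_ad G_ad G_L1 G_unb G_2nd).
  apply: eq_integral => w _; congr ereal_sup; apply/seteqP; split.
    by move=> _ [[//|n] _ <-]; exists n.
  by move=> _ [n _ <-]; exists n.+1.
move=> q1.
have EE n : 'E_P[fun w => (enorm (grad g (theta n.+1 w)) ^+ 2)%R]%E =
    (mean P (fun w => gsq g (x^~ w) n))%:E.
  rewrite unlock -mean_EFin.
    by apply: eq_integral => w _; rewrite enorm_sqr.
  apply: (bounded_adapted_L1 P F_filtration (n := n)).
  exact: (gsq_adb Lam_ge1 q_gt s0_gt0 g_lip' S_init' x_init S_rec' x_rec grad_ad).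
rewrite -(cvg_shiftS) /=.
under eq_fun do rewrite EE.
apply/fine_cvgP; split; first exact: nearW.
apply/cvgrPdist_le => delta delta0.
have [N HN] : exists N, forall n, (N <= n)%N ->
    mean P (fun w => gsq g (x^~ w) n) <= delta.
  exact: (mean_gsq_small F_filtration Lam_ge1 K'_ge1 q_gt
    alpha0_gt0 s0_gt0 g_ge0 g_diff g_lip' S_init' x_init S_rec' x_rec S_ad g_ad
    grad_ad G_ad G_L1 G_unb G_2nd).
exists N => // n Nn /=; rewrite sub0r normrN ger0_norm ?HN//.
by apply: mean_ge0 => w; exact: gsq_ge0.
Qed.
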